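(* Let $A$ be a bounded normal operator on $\mathcal{H}$, and let $\mathcal{G}$ be a countable set of vectors in $\mathcal{H}$ such that $\{A^n g\}_{g\in\mathcal{G},\,n\ge 0}$ is complete in $\mathcal{H}$. Let $\mu_\infty,\mu_1,\mu_2,\dots$ be the measures in the spectral representation of $A$. Then for every $1\le j\le\infty$ and for $\mu_j$-a.e. $z$, the system of vectors $\{\widetilde g_j(z)\}_{g\in\mathcal{G}}$ is complete in $\ell^2(\Omega_j)$. If in addition to being normal $A$ is also reductive, then for a countable set $\mathcal{G}\subset\mathcal{H}$, the system $\{A^n g\}_{g\in\mathcal{G},\,n\ge 0}$ is complete in $\mathcal{H}$ if and only if for every $1\le j\le\infty$ the system $\{\widetilde g_j(z)\}_{g\in\mathcal{G}}$ is complete in $\ell^2(\Omega_j)$ for $\mu_j$-a.e. $z$.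
   Context: $\mathcal{H}$ is an infinite-dimensional separable complex Hilbert space. A system of vectors is complete if its closed linear span is the whole space. An operator $A$ is reductive if for every closed invariant subspace $V$ of $A$, the orthogonal complement $V^\perp$ is also invariant under $A$. Spectral representation (spectral theorem with multiplicity): for a compactly supported non-negative regular Borel measure $\nu$ on $\mathbb{C}$, $N_\nu$ denotes multiplication by $z$ on $L^2(\nu)$, and $N_\nu^{(j)}$ the direct sum of $j$ copies of it, acting on $(L^2(\nu))^{(j)}$. For the normal operator $A$ there are mutually singular compactly supported non-negative Borel measures $\mu_j$, $j\in\mathbb{N}^*=\{1,2,\dots\}\cup\{\infty\}$ (some possibly zero), and a unitary $U:\mathcal{H}\to (L^2(\mu_\infty))^{(\infty)}\oplus L^2(\mu_1)\oplus (L^2(\mu_2))^{(2)}\oplus\cdots$ with $UAU^{-1}=N^{(\infty)}_{\mu_\infty}\oplus N_{\mu_1}\oplus N^{(2)}_{\mu_2}\oplus\cdots$; fix such $\mu_j$ and $U$. Put $\Omega_j=\{1,\dots,j\}$ for $j\in\mathbb{N}$ and $\Omega_\infty=\mathbb{N}$. For $g\in\mathcal{H}$ write $\widetilde g=Ug=(\widetilde g_j)_{j\in\mathbb{N}^*}$, where $\widetilde g_j$ is the component in $(L^2(\mu_j))^{(j)}$, regarded as a function $\mathbb{C}\to\ell^2(\Omega_j)$. *)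

(* Defs.v *)
From HB Require Import structures.
From mathcomp Require Import all_boot all_order all_algebra.
From mathcomp Require Import sesquilinear complex.
From mathcomp Require Import all_classical all_reals all_analysis.
From mathcomp Require Import ring.
Set Implicit Arguments.
Unset Strict Implicit.
Unset Printing Implicit Defensive.
Import Order.TTheory GRing.Theory Num.Theory.
Import numFieldNormedType.Exports.
Local Open Scope classical_set_scope.
Local Open Scope ring_scope.

Definition span (K : nzRingType) (V : lmodType K) (S : set V) : set V :=
  [set v | exists n (c : 'I_n -> K) (s : 'I_n -> V),
     (forall i, S (s i)) /\ v = \sum_(i < n) c i *: s i].

Definition complete_system (K : numFieldType) (V : normedModType K)
    (S : set V) : Prop :=
  closure (span S) = setT.

Section l2.
Variables (R : realType) (T : choiceType).
Implicit Types v w : T -> R[i].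

Definition sqnorm v : \bar R := \esum_(t in setT) ((Normc.normc (v t)) ^+ 2)%:E.

Lemma sqnorm_ge0 v : (0 <= sqnorm v)%E.
Proof. by apply: esum_ge0 => t _; rewrite lee_fin sqr_ge0. Qed.

Lemma esumZ_le (f : T -> \bar R) (c : R) : (forall t, 0 <= f t)%E -> 0 <= c ->
  (\esum_(t in setT) (c%:E * f t) <= c%:E * \esum_(t in setT) f t)%E.
Proof.
move=> f0 c0; apply: ge_ereal_sup => _ [A finA <-].
rewrite -ge0_mule_fsumr//; apply: lee_wpmul2l; first by rewrite lee_fin.
by apply: ereal_sup_ubound; exists A.
Qed.

Lemma sqnorm_comb v w (s t : R) u : 0 <= s -> 0 <= t ->
  (forall i, (Normc.normc (u i)) ^+ 2 <=
    s * (Normc.normc (v i)) ^+ 2 + t * (Normc.normc (w i)) ^+ 2) ->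
  (sqnorm u <= s%:E * sqnorm v + t%:E * sqnorm w)%E.
Proof.
move=> s0 t0 uvw.
apply: (@le_trans _ _ (\esum_(i in setT)
   (s%:E * ((Normc.normc (v i)) ^+ 2)%:E +
    t%:E * ((Normc.normc (w i)) ^+ 2)%:E))%E).
  by apply: le_esum => i _; rewrite -!EFinM -EFinD lee_fin.
rewrite esumD; last 2 first.
- by move=> i _; rewrite -EFinM lee_fin mulr_ge0// sqr_ge0.
- by move=> i _; rewrite -EFinM lee_fin mulr_ge0// sqr_ge0.
by apply: leeD; apply: esumZ_le => // i; rewrite lee_fin sqr_ge0.
Qed.

Definition l2_pred : {pred (T -> R[i])} := [pred v | (sqnorm v < +oo)%E].

Lemma normcD_le (a b : R[i]) :
  Normc.normc (a + b) <= Normc.normc a + Normc.normc b.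
Proof. exact: (@le_normcD R a b). Qed.

Lemma normc_ge0' (a : R[i]) : 0 <= Normc.normc a.
Proof. by case: a => x y; exact: sqrtr_ge0. Qed.

Lemma sqnormZ (a : R[i]) v :
  sqnorm (a *: v) = (((Normc.normc a) ^+ 2)%:E * sqnorm v)%E.
Proof.
have le b w : (sqnorm (b *: w) <= ((Normc.normc b) ^+ 2)%:E * sqnorm w)%E.
  rewrite -[leRHS]adde0 -[X in (_ + X)%E](mul0e (sqnorm w)).
  apply: sqnorm_comb; rewrite ?sqr_ge0// => i.
  by rewrite mul0r addr0 Normc.normcM exprMn.
apply/eqP; rewrite eq_le le /=.
have [->|a0] := eqVneq a 0.
  by rewrite Normc.normc0 expr0n/= mul0e sqnorm_ge0.
have na0 : Normc.normc a != 0 by apply: contra a0 => /eqP/Normc.eq0_normc ->.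
have := le a^-1 (a *: v); rewrite scalerA mulVf// scale1r => h.
apply: (le_trans (lee_wpmul2l _ h)); first by rewrite lee_fin sqr_ge0.
by rewrite muleA -EFinM Normc.normcV exprVn divff ?expf_neq0// mul1e.
Qed.

Lemma l2_submod_closed : submod_closed l2_pred.
Proof.
split.
  rewrite inE /= /sqnorm esum1// => t _.
  by rewrite Normc.normc0 expr0n.
move=> a u v; rewrite !inE /= => uoo voo.
apply: (@le_lt_trans _ _ (2%:E * sqnorm (a *: u) + 2%:E * sqnorm v)%E).
  apply: sqnorm_comb => // i.
  set x : R := Normc.normc ((a *: u) i); set y : R := Normc.normc (v i).
  apply: (@le_trans _ _ ((x + y) ^+ 2)).
    by rewrite ler_pXn2r// ?nnegrE ?addr_ge0 ?normc_ge0'//; exact: normcD_le.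
  by rewrite -subr_ge0 (_ : _ - _ = (x - y) ^+ 2) ?sqr_ge0//; ring.
rewrite sqnormZ lte_add_pinfty//; last by rewrite lte_mul_pinfty.
by rewrite !lte_mul_pinfty// ?mule_ge0// ?lee_fin ?sqr_ge0// sqnorm_ge0.
Qed.

HB.instance Definition _ :=
  GRing.isSubmodClosed.Build R[i] (T -> R[i]) l2_pred l2_submod_closed.

Record l2 := L2 { l2_val :> T -> R[i]; _ : l2_val \in l2_pred }.

HB.instance Definition _ := [isSub for l2_val].
HB.instance Definition _ := [Choice of l2 by <:].
HB.instance Definition _ := [SubChoice_isSubLmodule of l2 by <:].

Definition l2_norm (v : l2) : R[i] := (Num.sqrt (fine (sqnorm v)))%:C%C.

Lemma sqnorm_fineK (v : l2) : (fine (sqnorm v))%:E = sqnorm v.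
Proof. by rewrite fineK// ge0_fin_numE ?sqnorm_ge0//; case: v. Qed.

Lemma l2_norm_eq0 (v : l2) : l2_norm v = 0 -> v = 0.
Proof.
move=> /(congr1 (@complex.Re R)) /= /eqP; rewrite sqrtr_eq0 => v0.
have {v0}v0 : (sqnorm v <= 0)%E by rewrite -sqnorm_fineK lee_fin.
apply/val_inj/funext => t /=; apply: Normc.eq0_normc; apply/eqP.
rewrite -sqrf_eq0 eq_le sqr_ge0 andbT -lee_fin (le_trans _ v0)//.
apply: esum_ge; exists [set t]; last by rewrite fsbig_set1.
by split => //; exact: finite_set1.
Qed.

Lemma l2_normD (v w : l2) : l2_norm (v + w) <= l2_norm v + l2_norm w.
Proof.
have [->|v0] := eqVneq v 0; first by rewrite add0r lerDr lecR sqrtr_ge0.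
have [->|w0] := eqVneq w 0; first by rewrite addr0 lerDl lecR sqrtr_ge0.
have := contra_neq (@l2_norm_eq0 v) v0; have := contra_neq (@l2_norm_eq0 w) w0.
rewrite /l2_norm -rmorphD lecR.
set a := Num.sqrt (fine (sqnorm v)); set b := Num.sqrt (fine (sqnorm w)).
move=> b0 a0.
have {}a0 : 0 < a.
  by rewrite lt_def sqrtr_ge0 andbT; apply: contra_neq a0 => ->.
have {}b0 : 0 < b.
  by rewrite lt_def sqrtr_ge0 andbT; apply: contra_neq b0 => ->.
have va : sqnorm v = (a ^+ 2)%:E.
  by rewrite -sqnorm_fineK /a sqr_sqrtr// fine_ge0// sqnorm_ge0.
have wb : sqnorm w = (b ^+ 2)%:E.
  by rewrite -sqnorm_fineK /b sqr_sqrtr// fine_ge0// sqnorm_ge0.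
have ab0 : 0 <= a + b by rewrite addr_ge0// ltW.
suff vw : (sqnorm (l2_val (v + w)%R) <= ((a + b) ^+ 2)%:E)%E.
  rewrite (_ : a + b = Num.sqrt ((a + b) ^+ 2)); last first.
    by rewrite sqrtr_sqr ger0_norm.
  apply: ler_wsqrtr; rewrite -lee_fin.
  by rewrite (sqnorm_fineK (v + w)).
have -> : ((a + b) ^+ 2)%:E =
    (((a + b) / a)%:E * sqnorm v + ((a + b) / b)%:E * sqnorm w)%E.
  rewrite va wb -!EFinM -EFinD; congr EFin.
  by field; rewrite !gt_eqF.
apply: sqnorm_comb; rewrite ?divr_ge0// ?ltW// => i.
rewrite (_ : l2_val (v + w) i = v i + w i)//.
set x : R := Normc.normc (v i); set y : R := Normc.normc (w i).
apply: (@le_trans _ _ ((x + y) ^+ 2)).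
  by rewrite ler_pXn2r// ?nnegrE ?addr_ge0 ?normc_ge0'//; exact: normcD_le.
rewrite -subr_ge0.
rewrite (_ : _ - _ = (b * x - a * y) ^+ 2 / (a * b)).
  by rewrite divr_ge0 ?sqr_ge0// mulr_ge0// ltW.
by field; rewrite !gt_eqF.
Qed.

Lemma l2_normZ (c : R[i]) (v : l2) : l2_norm (c *: v) = `|c| * l2_norm v.
Proof.
rewrite /l2_norm sqnormZ -sqnorm_fineK -EFinM /= sqrtrM ?sqr_ge0//.
rewrite sqrtr_sqr ger0_norm ?normc_ge0' // rmorphM/=.
by congr (_ * _); case: c.
Qed.

HB.instance Definition _ :=
  Lmodule_isNormed.Build R[i] l2 l2_normD l2_normZ l2_norm_eq0.

End l2.

Definition separable (T : topologicalType) : Prop :=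
  exists2 D : set T, countable D & dense D.

Definition infinite_dimensional (K : nzRingType) (V : lmodType K) : Prop :=
  forall S : set V, finite_set S -> span S <> setT.

Section operators.
Variables (R : realType) (H : normedModType R[i]) (dot : {dot H for Num.conj}).
Implicit Types (A : {linear H -> H}) (V : set H).

Definition bounded_operator A : Prop :=
  exists M : R[i], forall x, `|A x| <= M * `|x|.

Definition adjoint A (B : {linear H -> H}) : Prop :=
  forall x y, dot (A x) y = dot x (B y).

Definition normal_operator A : Prop :=
  exists B : {linear H -> H},
    [/\ bounded_operator B, adjoint A B & forall x, A (B x) = B (A x)].

Definition closed_subspace V : Prop :=
  [/\ closed V, V 0 & forall (a : R[i]) x y, V x -> V y -> V (a *: x + y)].

Definition invariant A V : Prop := A @` V `<=` V.

Definition orthogonal_complement V : set H :=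
  [set x | forall y, V y -> dot x y = 0].

Definition reductive A : Prop :=
  forall V, closed_subspace V -> invariant A V ->
    invariant A (orthogonal_complement V).

Definition orbit_system A (G : set H) : set H :=
  [set v | exists g n, G g /\ v = iter n A g].

End operators.

(* C with its Borel sigma-algebra; R[i]^o carries the norm topology. *)
Definition complex_plane (R : realType) :=
  g_sigma_algebraType (@open (R[i])^o).

Definition compactly_supported (R : realType)
    (nu : {measure set (complex_plane R) -> \bar R}) : Prop :=
  exists K : set (R[i])^o,
    compact K /\ nu (~` K : set (complex_plane R)) = 0%E.

Definition mutually_singular d (T : measurableType d) (R : realType)
    (nu1 nu2 : {measure set T -> \bar R}) : Prop :=
  exists N, [/\ measurable N, nu1 N = 0%E & nu2 (~` N) = 0%E].

(* N* = {1, 2, ...} u {oo}: [Some n] stands for the multiplicity n.+1 and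
   [None] for oo. *)
Definition multiplicity := option nat.

(* Omega_j is indexed from 0. *)
Definition Omega (j : multiplicity) : countType :=
  if j is Some n then 'I_n.+1 : countType else nat : countType.

(* Representatives of the elements of the direct sum of the (L^2(mu_j))^(j):
   the j-th component is an l^2(Omega_j)-valued function. *)
Definition l2_fields (R : realType) :=
  forall j : multiplicity, complex_plane R -> l2 R (Omega j).

(* A finite Borel measure on C is automatically regular, and a regular
   (hence locally finite) one with compact support is finite. *)
Definition spectral_measures (R : realType) :=
  multiplicity -> {finite_measure set (complex_plane R) -> \bar R}.

Section spectral_representation.
Variables (R : realType) (mu : spectral_measures R).
Implicit Types F G : l2_fields R.

Definition field_sqnorm F : \bar R :=
  (\esum_(j in [set: multiplicity]) \esum_(k in [set: Omega j])
     \int[mu j]_z ((Normc.normc (F j z k)) ^+ 2)%:E)%E.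

Definition L2_field F : Prop :=
  (forall j k, measurable_fun [set: complex_plane R]
     (fun z => F j z k : complex_plane R)) /\
  (field_sqnorm F < +oo)%E.

Definition ae_eq_field F G : Prop :=
  forall j, {ae mu j, forall z, F j z = G j z}.

(* Equality in the direct sum of L^2 spaces is [ae_eq_field]. *)
Definition unitary_onto_L2 (H : normedModType R[i]) (U : H -> l2_fields R) :
    Prop :=
  [/\ forall x, L2_field (U x),
      forall (a : R[i]) x y,
        ae_eq_field (U (a *: x + y)) (fun j z => a *: U x j z + U y j z),
      forall x, field_sqnorm (U x) = ((Normc.normc `|x|) ^+ 2)%:E &
      forall F, L2_field F -> exists x, ae_eq_field (U x) F].

Definition spectral_representation (H : normedModType R[i])
    (A : {linear H -> H}) (U : H -> l2_fields R) : Prop :=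
  [/\ forall j, compactly_supported (mu j),
      forall i j, i <> j -> mutually_singular (mu i) (mu j),
      unitary_onto_L2 U &
      forall x, ae_eq_field (U (A x)) (fun j z => (z : R[i]) *: U x j z)].

End spectral_representation.

(* Main.v *)
Require Import Defs.
From HB Require Import structures.
From mathcomp Require Import all_boot all_order all_algebra.
From mathcomp Require Import sesquilinear complex.
From mathcomp Require Import all_classical all_reals all_analysis.
From mathcomp Require Import finmap measurable_realfun ring lra.
Set Implicit Arguments.
Unset Strict Implicit.
Unset Printing Implicit Defensive.
Import Order.TTheory GRing.Theory Num.Theory.
Import numFieldNormedType.Exports.
Local Open Scope classical_set_scope.
Local Open Scope ring_scope.

(** Write [U x j z] for the value at [z] of the [j]-th component of the vector
    [x] in the spectral representation; there [A] acts as multiplication by [z].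

    Necessity of complete fibres. Each vector [delta k] of the standard basis of
    l^2(Omega_j) gives a constant field, which is square integrable because
    [mu j] is finite, and hence represents some vector of the space. That vector
    is a limit of vectors spanned by the orbits, whose values at almost every [z]
    lie in the span of the [U g j z] ([span_orbit_fibre]). Since convergence in
    norm yields pointwise approximation almost everywhere ([ae_approximation],
    by Chebyshev's inequality), at almost every [z] every [delta k] lies in the
    closed span of the [U g j z], which is therefore everything
    ([complete_fibres]). No measurable selection is needed.

    Sufficiency for reductive operators. Let [V] be the closed span of the
    orbits and [W] its orthogonal complement; by the projection theorem it is
    enough to show that [W] is trivial. As [V] is invariant, [W] is invariant
    under multiplication by the conjugate of [z], which represents the adjoint
    of [A] ([conj_adjoint]); as [A] is reductive, [W] is also invariant under
    [A]. The functions by which multiplication preserves [W] are stable under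
    sums, products and bounded pointwise limits ([multiplier_cvg]); starting
    from [z] and its conjugate, explicit polynomials ([threshold]) converge to
    the characteristic functions of discs on the bounded set carrying the
    spectral measures ([spectral_bound]), so that the characteristic functions
    of all Borel sets preserve [W] ([multiplier_cindic]).

    Let now [f] be in [W] and [g] in [V]. For every Borel set [E] the product of
    [f] by the characteristic function of [E] is orthogonal to [g]. Taking for
    [E] the Borel subsets of a set carrying [mu j] and negligible for the other
    spectral measures, and comparing integrals, one gets that the real
    part of the inner product of [U f j z] and [U g j z] vanishes for almost all
    [z] ([ae_pythagorean]). With [g] ranging over the generators and their
    multiples by the imaginary unit, [U f j z] is orthogonal to a complete
    system, hence zero, for almost all [z] ([pythagorean_complete]); that is,
    [f = 0].

    Orthogonality in l^2 is expressed by Pythagoras' identity for norms, so that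
    no complex-valued sum or integral is ever formed. *)


(** * Complex numbers and Borel functions with complex values *)

Section complex_numbers.
Variable R : realType.
Implicit Types z w : R[i].

Lemma sqr_normcE z : Normc.normc z ^+ 2 = complex.Re z ^+ 2 + complex.Im z ^+ 2.
Proof. by case: z => a b /=; rewrite sqr_sqrtr// addr_ge0// sqr_ge0. Qed.

Lemma norm_normc z : `|z| = (Normc.normc z)%:C%C.
Proof. by case: z. Qed.

Lemma norm_normcE (z : R[i]^o) : `|z| = (Normc.normc z)%:C%C.
Proof. by case: z. Qed.

Lemma posc z : 0 < z -> exists2 r : R, 0 < r & z = r%:C%C.
Proof. by case: z => a b; rewrite ltcE/= => /andP[/eqP -> a0]; exists a. Qed.

Lemma normc_lt z (r : R) : 0 <= r ->
  (Normc.normc z < r) = (complex.Re z ^+ 2 + complex.Im z ^+ 2 < r ^+ 2).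
Proof.
by move=> r0; rewrite -sqr_normcE ltr_pXn2r// nnegrE normc_ge0'.
Qed.

Lemma normc_Re_Im_le z :
  Normc.normc z <= `|complex.Re z| + `|complex.Im z|.
Proof.
rewrite -(@ler_pXn2r _ 2)// ?nnegrE ?addr_ge0 ?normc_ge0'//.
rewrite sqr_normcE sqrrD !real_normK ?num_real//.
by rewrite addrAC lerDl mulrn_wge0// mulr_ge0.
Qed.

(** Every open set of the plane is a countable union of balls whose centre is
    a rational point and whose radius is the inverse of a positive integer. *)
Lemma open_rational_balls (O : set R[i]^o) : open O ->
  exists B : set (rat * rat * nat),
    O = \bigcup_(q in B) [set z : R[i]^o |
      Normc.normc (z - (ratr q.1.1 +i* ratr q.1.2)%C) < q.2.+1%:R^-1].
Proof.
move=> oO; pose ball (q : rat * rat * nat) := [set z : R[i]^o |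
      Normc.normc (z - (ratr q.1.1 +i* ratr q.1.2)%C) < q.2.+1%:R^-1].
exists [set q | ball q `<=` O].
apply/seteqP; split=> [z Oz|z [q qO qz]]; last exact: qO.
have /nbhs_ballP[e e0 ezO] : nbhs z O by exact: open_nbhs_nbhs.
have [r r0 er] := posc e0.
have zO w : Normc.normc (w - z) < r -> O w.
  move=> wz; apply: ezO; rewrite -ball_normE/= er norm_normcE ltcR.
  by rewrite -normcN opprB.
have [n nr] : exists n : nat, n.+1%:R^-1 < r / 2.
  have := near_infty_natSinv_lt (PosNum (divr_gt0 r0 (ltr0Sn R 1))).
  by case=> n _ /(_ n (leqnn n)); exists n.
have d0 : 0 < n.+1%:R^-1 / 2 :> R by rewrite divr_gt0// invr_gt0.
have pick (x : R) : exists q : rat, `|x - ratr q| < n.+1%:R^-1 / 2.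
  have /rat_in_itvoo[q] : x - n.+1%:R^-1 / 2 < x + n.+1%:R^-1 / 2.
    by rewrite ltrD2l gtrN.
  rewrite in_itv/= => /andP[q1 q2]; exists q.
  by rewrite distrC ltr_distl q1.
have [p zp] := pick (complex.Re z); have [q zq] := pick (complex.Im z).
have zc : Normc.normc (z - (ratr p +i* ratr q)%C) < n.+1%:R^-1.
  apply: le_lt_trans (normc_Re_Im_le _) _.
  rewrite !raddfB/= [ltRHS]splitr; exact: ltrD.
exists (p, q, n) => // w /= wz; apply: zO.
rewrite (_ : w - z = (w - (ratr p +i* ratr q)%C) -
   (z - (ratr p +i* ratr q)%C)); last by rewrite opprB addrA subrK.
apply: (le_lt_trans (normcD_le _ _)); rewrite normcN [ltRHS]splitr.
by apply: ltrD; exact: lt_trans nr.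
Qed.

End complex_numbers.

Section complex_measurability.
Variables (R : realType) (d : measure_display) (T : measurableType d).
Implicit Types f g : T -> complex_plane R.

Lemma continuous_measurable_complex (h : R[i]^o -> R) : continuous h ->
  measurable_fun [set: complex_plane R] (h : complex_plane R -> R).
Proof.
move=> /continuousP ch.
apply: (measurability _ (RGenOpens.measurableE R)) => _ [_ [a [b ->]] <-].
rewrite setTI; apply: sub_sigma_algebra.
exact/ch/interval_open.
Qed.


Lemma continuous_Re : continuous (@complex.Re R : R[i]^o -> R).
Proof.
move=> z B /nbhs_ballP[e /= e0 eB]; apply/nbhs_ballP.
exists e%:C%C => /= [|w]; first by rewrite ltcR.
rewrite -ball_normE/= norm_normcE ltcR => zw; apply: eB.
rewrite -ball_normE/= -raddfB/=; apply: le_lt_trans zw; rewrite -lecR.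
by have := normc_ge_Re (z - w); rewrite norm_normc.
Qed.

Lemma continuous_Im : continuous (@complex.Im R : R[i]^o -> R).
Proof.
move=> z B /nbhs_ballP[e /= e0 eB]; apply/nbhs_ballP.
exists e%:C%C => /= [|w]; first by rewrite ltcR.
rewrite -ball_normE/= norm_normcE ltcR => zw; apply: eB.
rewrite -ball_normE/= -raddfB/=; apply: le_lt_trans zw.
rewrite -(@ler_pXn2r _ 2) ?nnegrE ?normc_ge0'// sqr_normcE.
by rewrite real_normK ?num_real// lerDr sqr_ge0.
Qed.

(** Measurability with respect to the Borel sets of the plane is measurability
    of the real and imaginary parts. *)
Lemma measurable_complexP f : measurable_fun setT f <->
  measurable_fun setT (fun t => complex.Re (f t : R[i])) /\
  measurable_fun setT (fun t => complex.Im (f t : R[i])).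
Proof.
split=> [mf|[mr mi]].
  split.
    apply: (measurableT_comp
      (f := (@complex.Re R : complex_plane R -> R))) => //.
    exact: (continuous_measurable_complex continuous_Re).
  apply: (measurableT_comp (f := (@complex.Im R : complex_plane R -> R))) => //.
  exact: (continuous_measurable_complex continuous_Im).
have mE : @measurable _ (complex_plane R) = <<s (@open R[i]^o) >> by [].
apply: (measurability _ mE) => _ [E oE <-].
rewrite setTI; have [B ->] := open_rational_balls oE.
rewrite preimage_bigcup bigcup_mkcond.
apply: countable_bigcupT_measurable => // q; case: ifP => // _.
have r0 : 0 <= q.2.+1%:R^-1 :> R by rewrite invr_ge0.
rewrite /preimage/=.
under eq_set => z do rewrite normc_lt// !raddfB/=.
rewrite -[X in measurable X]setTI; apply: measurable_fun_ltr => //.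
by apply: measurable_funD; apply: measurable_funX; apply: measurable_funB.
Qed.

Lemma measurable_sqr_normc f : measurable_fun setT f ->
  measurable_fun setT (fun t => Normc.normc (f t : R[i]) ^+ 2).
Proof.
move=> /measurable_complexP[mr mi].
under eq_fun do rewrite sqr_normcE.
by apply: measurable_funD; exact: measurable_funX.
Qed.

Lemma measurable_complexD f g :
  measurable_fun setT f -> measurable_fun setT g ->
  measurable_fun setT (fun t => (f t : R[i]) + g t : complex_plane R).
Proof.
move=> /measurable_complexP[fr fi] /measurable_complexP[gr gi].
apply/measurable_complexP; split; under eq_fun do rewrite raddfD/=;
  exact: measurable_funD.
Qed.

Lemma measurable_complexM f g :
  measurable_fun setT f -> measurable_fun setT g ->
  measurable_fun setT (fun t => (f t : R[i]) * g t : complex_plane R).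
Proof.
move=> /measurable_complexP[fr fi] /measurable_complexP[gr gi].
have ReM (z w : R[i]) : complex.Re (z * w) =
    complex.Re z * complex.Re w - complex.Im z * complex.Im w.
  by case: z w => [a b] [c e].
have ImM (z w : R[i]) : complex.Im (z * w) =
    complex.Re z * complex.Im w + complex.Im z * complex.Re w.
  by case: z w => [a b] [c e].
apply/measurable_complexP; split.
  under eq_fun do rewrite ReM.
  by apply: measurable_funB; exact: measurable_funM.
under eq_fun do rewrite ImM.
by apply: measurable_funD; exact: measurable_funM.
Qed.

Lemma measurable_complex_conj f : measurable_fun setT f ->
  measurable_fun setT (fun t => (f t : R[i])^*%C : complex_plane R).
Proof.
move=> /measurable_complexP[fr fi].
have ReJ (z : R[i]) : complex.Re z^*%C = complex.Re z by case: z.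
have ImJ (z : R[i]) : complex.Im z^*%C = - complex.Im z by case: z.
apply/measurable_complexP; split.
  by under eq_fun do rewrite ReJ.
by under eq_fun do rewrite ImJ; exact: measurable_funN.
Qed.

Lemma measurable_complex_cst (a : R[i]) :
  measurable_fun setT ((fun=> a) : T -> complex_plane R).
Proof. exact: measurable_cst. Qed.

Lemma measurable_complex_real (h : T -> R) : measurable_fun setT h ->
  measurable_fun setT (fun t => (h t)%:C%C : complex_plane R).
Proof. by move=> mh; apply/measurable_complexP; split. Qed.

End complex_measurability.

(** * Sums of nonnegative families over countable types *)

Section countable_sums.
Variable R : realType.

(** A convergent sum has small tails. *)
Lemma esum_tail (T : choiceType) (f : T -> \bar R) (e : R) :
  (forall t, 0 <= f t)%E -> (\esum_(t in setT) f t < +oo)%E -> 0 < e ->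
  exists2 A : set T, finite_set A & (\esum_(t in ~` A) f t <= e%:E)%E.
Proof.
move=> f0 foo e0; set S := \esum_(t in setT) f t.
have S0 : (0 <= S)%E by apply: esum_ge0.
have Sfin : S \is a fin_num by rewrite ge0_fin_numE.
have [_ [A [finA _] <-] SA] : exists2 x,
    [set \sum_(x \in A) f x | A in fsets setT]%E x & (S - e%:E < x)%E.
  exact: ub_ereal_sup_adherent.
exists A => //.
have SE : S = (\sum_(x \in A) f x + \esum_(t in ~` A) f t)%E.
  by rewrite /S (esumID A)// !setTI esum_fset.
have A0 : (0 <= \sum_(x \in A) f x)%E by apply: fsume_ge0.
have tail0 : (0 <= \esum_(t in ~` A) f t)%E by apply: esum_ge0.
move: SA Sfin; rewrite SE.
case: (\sum_(x \in A) f x)%E A0 => [a| |]//= _;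
  case: (\esum_(t in ~` A) f t)%E tail0 => [b| |]//= _.
by rewrite lte_fin lee_fin => ? _; lra.
Qed.

(** Dominated convergence for sums of nonnegative terms. *)
Lemma esum_cvg0 (T : choiceType) (f : nat -> T -> \bar R) (g : T -> \bar R) :
  (forall n t, 0 <= f n t)%E -> (forall n t, f n t <= g t)%E ->
  (\esum_(t in setT) g t < +oo)%E -> (forall t, f ^~ t @ \oo --> 0%E) ->
  (fun n => \esum_(t in setT) f n t)%E @ \oo --> 0%E.
Proof.
move=> f0 fg goo fcvg.
have g0 t : (0 <= g t)%E := le_trans (f0 0 t) (fg 0 t).
have S0 n : (0 <= \esum_(t in setT) f n t)%E by apply: esum_ge0.
have Sg n : (\esum_(t in setT) f n t <= \esum_(t in setT) g t)%E.
  by apply: le_esum.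
apply/fine_cvgP; split.
  by apply: nearW => n; rewrite ge0_fin_numE// (le_lt_trans (Sg n)).
apply/cvgrPdist_le => e e0.
have [A finA gA] := esum_tail g0 goo (divr_gt0 e0 (ltr0Sn R 1)).
have : (fun n => \sum_(t \in A) f n t)%E @ \oo --> 0%E.
  rewrite (_ : (fun n => _) = fun n => (\sum_(t <- fset_set A) f n t)%E).
    have h0 t : true -> \forall n \near \oo, (0 <= f n t)%E.
      by move=> _; apply: nearW.
    have := @cvg_nnesum _ _ _ _ _ (fset_set A) (fun t n => f n t) (fun=> 0%E)
      xpredT h0 (fun t _ => fcvg t).
    by rewrite big1 //; apply.
  by apply/funext => n; rewrite fsbig_finite.
move=> /fine_cvgP[finS] /cvgrPdist_le /(_ _ (divr_gt0 e0 (ltr0Sn R 1))) near1.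
near=> n.
rewrite sub0r normrN ger0_norm ?fine_ge0// -lee_fin fineK; last first.
  by rewrite ge0_fin_numE// (le_lt_trans (Sg n)).
rewrite (esumID A)// !setTI esum_fset// [e in leRHS]splitr EFinD.
rewrite leeD//; last first.
  by apply: le_trans gA; apply: le_esum.
have : `|0 - fine (\sum_(t \in A) f n t)| <= e / 2 by near: n.
rewrite sub0r normrN ger0_norm ?fine_ge0 ?fsume_ge0// -lee_fin fineK//.
by near: n.
Unshelve. all: by end_near. Qed.

(** A sum over a countable type, as a series indexed by the codes of its
    elements; the integers which code nothing contribute 0. *)
Lemma esum_nneseries (T : countType) (f : T -> \bar R) :
  (forall t, 0 <= f t)%E ->
  (\esum_(t in setT) f t = \sum_(0 <= n <oo) oapp f 0 (@pickle_inv T n))%E.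
Proof.
move=> f0; rewrite nneseries_esumT; last by move=> n; case: pickle_inv.
rewrite (esumID (@choice.pickle T @` setT)); last first.
  by move=> n _; case: pickle_inv.
rewrite [X in (_ + X)%E]esum1 ?adde0 ?setTI; last first.
  move=> n /=; case E : (pickle_inv n) => [t|]// nr; exfalso; apply: nr.
  by exists t => //; move: (@pickle_invK T n); rewrite E.
rewrite (reindex_esum setT _ (@choice.pickle T)).
  by apply: eq_esum => t _; rewrite pickleK_inv.
by split=> // s t _ _; exact: (pcan_inj pickleK).
Qed.

Variables (d : measure_display) (X : measurableType d) (T : countType).
Variable f : T -> X -> \bar R.
Hypothesis f0 : forall t x, (0 <= f t x)%E.
Hypothesis mf : forall t, measurable_fun setT (f t).

Let F n x := oapp (f ^~ x) 0%E (@pickle_inv T n).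

Let mF n : measurable_fun setT (F n).
Proof.
by rewrite /F; case: pickle_inv => [t|] /=; [exact: mf|exact: measurable_cst].
Qed.

Let F0 n x : (0 <= F n x)%E.
Proof. by rewrite /F; case: pickle_inv => [t|] /=. Qed.

Lemma measurable_esum :
  measurable_fun setT (fun x => \esum_(t in setT) f t x)%E.
Proof.
under eq_fun do rewrite esum_nneseries//.
by apply: (ge0_emeasurable_sum (h := F) (P := xpredT)) => n *;
  [exact: F0|exact: mF].
Qed.

Lemma integral_esum (mu : {measure set X -> \bar R}) (E : set X) :
  measurable E ->
  (\int[mu]_(x in E) (\esum_(t in setT) f t x) =
   \esum_(t in setT) \int[mu]_(x in E) f t x)%E.
Proof.
move=> mE; under eq_integral do rewrite esum_nneseries//.
rewrite esum_nneseries; last by move=> t; apply: integral_ge0.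
rewrite (@integral_nneseries _ _ _ mu E mE F)//; last first.
  by move=> n; apply: measurable_funS (mF n).
apply: eq_eseriesr => n _; rewrite /F; case: pickle_inv => //=.
by rewrite integral0.
Qed.

End countable_sums.

(** * Spans and closures in complex normed modules *)

Section closure_span.
Variables (R : realType) (V : normedModType R[i]).
Implicit Types (x y : V) (S : set V).

(** The norm of a complex normed module, as a real number. *)
Definition rnorm x : R := Normc.normc `|x|.

Lemma rnormE x : `|x| = (rnorm x)%:C%C.
Proof. by rewrite /rnorm -norm_normc normr_id. Qed.

Lemma rnorm_ge0 x : 0 <= rnorm x. Proof. exact: normc_ge0'. Qed.

Lemma rnorm0 : rnorm 0 = 0. Proof. by rewrite /rnorm normr0 Normc.normc0. Qed.

Lemma rnorm_eq0 x : rnorm x = 0 -> x = 0.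
Proof. by move=> x0; apply/normr0_eq0; rewrite rnormE x0. Qed.

Lemma rnormD_le x y : rnorm (x + y) <= rnorm x + rnorm y.
Proof. by rewrite -lecR rmorphD/= -!rnormE ler_normD. Qed.

Lemma rnormZ (a : R[i]) x : rnorm (a *: x) = Normc.normc a * rnorm x.
Proof. by apply: complexI; rewrite rmorphM/= -!rnormE normrZ norm_normc. Qed.

Lemma rnormN x : rnorm (- x) = rnorm x.
Proof. by rewrite /rnorm normrN. Qed.

Lemma closure_rnormP S x :
  closure S x <-> forall e : R, 0 < e -> exists2 y, S y & rnorm (x - y) < e.
Proof.
split=> [xS e e0|xS B /nbhs_ballP[_/posnumP[e] eB]].
  have eC : 0 < e%:C%C :> R[i] by rewrite ltcR.
  have [y [Sy]] := xS _ (nbhsx_ballx x _ eC).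
  by rewrite -ball_normE/= rnormE ltcR => xy; exists y.
have [r r0 er] := posc (gt0 e).
have [y Sy xy] := xS _ r0; exists y; split => //; apply: eB.
by rewrite -ball_normE/= er rnormE ltcR.
Qed.

Lemma span_gen S x : S x -> Defs.span S x.
Proof.
move=> Sx; exists 1%N, (fun=> 1), (fun=> x); split => //.
by rewrite big_ord1 scale1r.
Qed.

Lemma span0 S : Defs.span S 0.
Proof.
by exists 0%N, (fun=> 0), (fun=> 0); split; [case|rewrite big_ord0].
Qed.

Lemma span_lin S (a : R[i]) x y :
  Defs.span S x -> Defs.span S y -> Defs.span S (a *: x + y).
Proof.
move=> [m [c [s [sS ->]]]] [n [b [t [tS ->]]]].
exists (m + n)%N,
  (fun i => match fintype.split i with inl i => a * c i | inr i => b i end),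
  (fun i => match fintype.split i with inl i => s i | inr i => t i end).
split=> [i|]; first by case: fintype.split.
rewrite big_split_ord/= scaler_sumr; congr (_ + _); apply: eq_bigr => i _.
  by rewrite (unsplitK (inl i)) scalerA.
by rewrite (unsplitK (inr i)).
Qed.

Lemma span_sub S (W : set V) : W 0 ->
  (forall (a : R[i]) x y, W x -> W y -> W (a *: x + y)) ->
  S `<=` W -> Defs.span S `<=` W.
Proof.
move=> W0 Wlin SW _ [n [c [s [sS ->]]]].
elim: n c s sS => [|n IH] c s sS; first by rewrite big_ord0.
by rewrite big_ord_recl; apply: Wlin; [exact/SW/sS|apply: IH => i; exact: sS].
Qed.

Lemma closure_lin S :
  (forall (a : R[i]) x y, S x -> S y -> S (a *: x + y)) ->
  forall (a : R[i]) x y, closure S x -> closure S y -> closure S (a *: x + y).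
Proof.
move=> Slin a x y /closure_rnormP xS /closure_rnormP yS.
apply/closure_rnormP => e e0.
have a1 : 0 < Normc.normc a + 1 by rewrite ltr_wpDl// normc_ge0'.
have [u Su xu] := xS _ (divr_gt0 e0 (mulr_gt0 (ltr0Sn R 1) a1)).
have [v Sv yv] := yS _ (divr_gt0 e0 (ltr0Sn R 1)).
exists (a *: u + v); first exact: Slin.
rewrite opprD addrACA -scalerBr (le_lt_trans (rnormD_le _ _))//.
rewrite rnormZ [ltRHS]splitr ler_ltD//.
apply: (@le_trans _ _ ((Normc.normc a + 1) * rnorm (x - u))).
  by rewrite ler_wpM2r ?rnorm_ge0// lerDl.
by move: xu; rewrite invfM mulrA ltr_pdivlMr// mulrC => /ltW.
Qed.

Lemma closure_span_subspace S : closed_subspace (closure (Defs.span S)).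
Proof.
split; first exact: closed_closure.
  exact/subset_closure/span0.
exact/closure_lin/span_lin.
Qed.

Lemma closed_subspaceD (W : set V) x y :
  closed_subspace W -> W x -> W y -> W (x + y).
Proof. by move=> [_ _ Wlin] Wx Wy; rewrite -(scale1r x); exact: Wlin. Qed.

Lemma closed_subspaceZ (W : set V) (a : R[i]) x :
  closed_subspace W -> W x -> W (a *: x).
Proof. by move=> [_ W0 Wlin] Wx; rewrite -(addr0 (a *: x)); exact: Wlin. Qed.

End closure_span.

Section l2_geometry.
Variables (R : realType) (T : countType).
Implicit Types u v w : l2 R T.

(** The square of the norm of a vector of l^2, as a real number. *)
Definition sq v : R := fine (sqnorm v).

Lemma sqE v : (sq v)%:E = sqnorm v. Proof. exact: sqnorm_fineK. Qed.

Lemma sq_ge0 v : 0 <= sq v. Proof. by rewrite fine_ge0// sqnorm_ge0. Qed.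

Lemma rnorm_sq v : rnorm v = Num.sqrt (sq v).
Proof.
apply: complexI; rewrite -rnormE; exact: (erefl (l2_norm v)).
Qed.

Lemma sq_rnorm v : sq v = rnorm v ^+ 2.
Proof. by rewrite rnorm_sq sqr_sqrtr// sq_ge0. Qed.

Let psum n v : R :=
  \sum_(0 <= k < n)
    oapp (fun t => Normc.normc (v t) ^+ 2) 0 (@choice.pickle_inv T k).

Let psum_cvg v : psum ^~ v @ \oo --> sq v.
Proof.
pose f k :=
  (oapp (fun t => (Normc.normc (v t) ^+ 2)%:E) 0 (@choice.pickle_inv T k))%E.
have f0 k : (0 <= f k)%E.
  by rewrite /f; case: pickle_inv => //= t; rewrite lee_fin sqr_ge0.
have fE n : (psum n v)%:E = (\sum_(0 <= k < n) f k)%E.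
  by rewrite /psum -sumEFin; apply: eq_bigr => k _; rewrite /f; case: pickle_inv.
have : (fun n => (psum n v)%:E) @ \oo --> (sq v)%:E.
  under eq_fun do rewrite fE.
  rewrite sqE /sqnorm esum_nneseries; last by move=> t; rewrite lee_fin sqr_ge0.
  by apply: is_cvg_nneseries => k _ _; exact: f0.
by move/fine_cvgP => [_].
Qed.

(** A quadratic identity satisfied coordinatewise is satisfied by the squares of
    the norms. *)
Lemma sq_identity (s : seq (R * l2 R T)) :
  (forall t, \sum_(p <- s) p.1 * Normc.normc (p.2 t) ^+ 2 = 0) ->
  \sum_(p <- s) p.1 * sq p.2 = 0.
Proof.
move=> s0.
have : (fun n => \sum_(p <- s) p.1 * psum n p.2) @ \oo -->
    \sum_(p <- s) p.1 * sq p.2.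
  elim: (s) => [|p r IH]; under eq_fun do rewrite ?big_nil ?big_cons.
    by rewrite big_nil; exact: cvg_cst.
  by rewrite big_cons; apply: cvgD IH; apply: cvgMl_tmp; exact: psum_cvg.
rewrite (_ : (fun n => _) = fun=> 0).
  by move/cvg_lim => <-//; rewrite lim_cst.
apply/funext => n; under eq_bigr do rewrite /psum mulr_sumr.
rewrite exchange_big/= big1// => k _.
by case: pickle_inv => [t|]/=; [exact: s0|rewrite big1// => p _; rewrite mulr0].
Qed.

End l2_geometry.

(** * Orthogonality and the standard basis in l^2 *)

(* Coordinates of sums and multiples stay folded under simplification. *)
#[local] Arguments l2_val : simpl never.

Section l2_coordinates.
Variables (R : realType) (T : countType).
Implicit Types (t : T) (v w : l2 R T).

Lemma l2_valD v w t : (v + w) t = v t + w t. Proof. by []. Qed.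
Lemma l2_valZ (a : R[i]) v t : (a *: v) t = a * v t. Proof. by []. Qed.
Lemma l2_valN v t : (- v) t = - v t. Proof. by []. Qed.
Lemma l2_val0 t : (0 : l2 R T) t = 0. Proof. by []. Qed.
Lemma l2_val_sum I (r : seq I) (F : I -> l2 R T) t :
  (\sum_(i <- r) F i) t = \sum_(i <- r) F i t.
Proof. by elim/big_rec2 : _ => // i x y _ <-. Qed.

End l2_coordinates.

Section l2_orthogonality.
Variables (R : realType) (T : countType).
Implicit Types u v w : l2 R T.

(** Orthogonality of [v] to the real line through [w], expressed by
    Pythagoras' identity: the real part of the inner product vanishes. *)
Definition pythagorean v w := sq (v + w) = sq v + sq w.

Lemma pythagorean0 v : pythagorean v 0.
Proof. by rewrite /pythagorean addr0 [sq 0]sq_rnorm rnorm0 expr0n/= addr0. Qed.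

Lemma pythagoreanD v w w' :
  pythagorean v w -> pythagorean v w' -> pythagorean v (w + w').
Proof.
rewrite /pythagorean.
have := @sq_identity R T [:: (1, v + (w + w')); (1, v); (1, w); (1, w');
  (-1, v + w); (-1, v + w'); (-1, w + w')].
rewrite !big_cons big_nil/= => /(_ _)/wrap[|]; last by lra.
by move=> t; rewrite !big_cons big_nil/= !l2_valD !sqr_normcE !raddfD/=; ring.
Qed.

Lemma pythagoreanZ v w (a : R) : pythagorean v w -> pythagorean v (a%:C%C *: w).
Proof.
rewrite /pythagorean.
have := @sq_identity R T [:: (1, v + a%:C%C *: w); (a - 1, v); (- a, v + w);
  (a - a ^+ 2, w)].
have := @sq_identity R T [:: (1, a%:C%C *: w); (- a ^+ 2, w)].
have ReZ z : complex.Re (a%:C%C * z) = a * complex.Re z.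
  by case: z => x y /=; rewrite mul0r subr0.
have ImZ z : complex.Im (a%:C%C * z) = a * complex.Im z.
  by case: z => x y /=; rewrite mul0r addr0.
rewrite !big_cons !big_nil/= => /(_ _)/wrap[|aw].
  move=> t; rewrite !big_cons big_nil/= l2_valZ !sqr_normcE.
  by rewrite ReZ ImZ; ring.
move=> /(_ _)/wrap[|].
  move=> t; rewrite !big_cons big_nil/= !l2_valD !l2_valZ !sqr_normcE !raddfD/=.
  by rewrite ReZ ImZ; ring.
by move=> h e; rewrite e in h; nra.
Qed.

(** A vector orthogonal to the complex lines through the elements of [S] is
    orthogonal to their span. *)
Lemma pythagorean_span v (S : set (l2 R T)) w :
  (forall g, S g -> pythagorean v g /\ pythagorean v ('i%C *: g)) ->
  Defs.span S w -> pythagorean v w.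
Proof.
move=> Sv.
suff : Defs.span S `<=` [set g | pythagorean v g /\ pythagorean v ('i%C *: g)].
  by move=> h /h[].
apply: span_sub => /=; [|move=> a x y [vx vix] [vy viy]|exact: Sv].
  by rewrite scaler0; split; exact: pythagorean0.
have aE : a = (complex.Re a)%:C%C + (complex.Im a)%:C%C * 'i%C.
  by rewrite [LHS]complexE mulrC.
split.
  apply: pythagoreanD vy; rewrite [a]aE scalerDl -scalerA.
  by apply: pythagoreanD; exact: pythagoreanZ.
rewrite scalerDr; apply: pythagoreanD viy; rewrite scalerA.
have -> : 'i%C * a = (complex.Re a)%:C%C * 'i%C + (- complex.Im a)%:C%C.
  rewrite [a in LHS]aE mulrDr mulrCA -expr2 sqr_i mulrN1 mulrC.
  by rewrite [(- _)%:C%C]rmorphN.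
rewrite scalerDl -scalerA.
by apply: pythagoreanD; exact: pythagoreanZ.
Qed.

(** A vector orthogonal to a complete system is zero. *)
Lemma pythagorean_complete v (S : set (l2 R T)) :
  (forall g, S g -> pythagorean v g /\ pythagorean v ('i%C *: g)) ->
  complete_system S -> v = 0.
Proof.
move=> Sv cS; apply: rnorm_eq0; apply/eqP; rewrite eq_le rnorm_ge0 andbT.
apply/ler_addgt0Pl => e e0; rewrite addr0.
have : closure (Defs.span S) v by rewrite cS.
move=> /closure_rnormP/(_ _ e0)[w Sw /ltW]; apply: le_trans.
rewrite -(@ler_pXn2r _ 2) ?nnegrE ?rnorm_ge0// -!sq_rnorm.
have := pythagoreanZ (-1) (pythagorean_span Sv Sw).
by rewrite /pythagorean rmorphN1 scaleN1r => ->; rewrite lerDl sq_ge0.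
Qed.

End l2_orthogonality.

Section l2_basis.
Variables (R : realType) (T : countType).
Implicit Types (k t : T) (v : l2 R T).

Let delta_fun k : T -> R[i] := fun t => (t == k)%:R.

Lemma sqnorm_delta_fun k : (sqnorm (delta_fun k) = 1)%E.
Proof.
rewrite /sqnorm (esumID [set k])//; last by move=> t _; rewrite lee_fin sqr_ge0.
rewrite setTI esum_set1 ?lee_fin ?sqr_ge0//.
rewrite /delta_fun eqxx Normc.normc1 expr1n esum1 ?adde0// => t [_ /= tk].
by rewrite (introF eqP tk) Normc.normc0 expr0n.
Qed.

Fact delta_subproof k : delta_fun k \in @l2_pred R T.
Proof. by rewrite inE /= sqnorm_delta_fun ltry. Qed.

(** The standard basis of l^2. *)
Definition delta k : l2 R T := L2 (delta_subproof k).

Lemma deltaE k t : delta k t = (t == k)%:R. Proof. by []. Qed.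

Lemma sqnorm_delta k : (sqnorm (delta k) = 1)%E.
Proof. exact: sqnorm_delta_fun. Qed.

(** The standard basis is complete: a vector is approximated by its finite
    truncations. *)
Lemma delta_dense (W : set (l2 R T)) : closed_subspace W ->
  (forall k, W (delta k)) -> W = setT.
Proof.
move=> Wsub Wd; apply/seteqP; split=> // v _.
have [Wcl W0 Wlin] := Wsub; apply: Wcl; apply/closure_rnormP => e e0.
have [A finA vA] : exists2 A : set T, finite_set A &
    (\esum_(t in ~` A) (Normc.normc (v t) ^+ 2)%:E <= ((e / 2) ^+ 2)%:E)%E.
  apply: esum_tail => [t||]; first by rewrite lee_fin sqr_ge0.
    by case: v.
  by rewrite exprn_gt0// divr_gt0.
exists (\sum_(k <- fset_set A) v k *: delta k).
  elim/big_ind : _ => // [x y|k _]; first exact: closed_subspaceD.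
  exact: closed_subspaceZ.
apply: (@le_lt_trans _ _ (e / 2)); last by rewrite gtr_pMr// invf_lt1// ltr1n.
rewrite -(@ler_pXn2r _ 2) ?nnegrE ?rnorm_ge0 ?divr_ge0 ?(ltW e0)//.
set u := (X in rnorm X); suff : ((sq u)%:E <= ((e / 2) ^+ 2)%:E)%E.
  by rewrite lee_fin sq_rnorm.
rewrite (sqE u) /u; apply: le_trans vA.
rewrite /sqnorm (esumID A); last by move=> t _; rewrite lee_fin sqr_ge0.
have coord t : (v - \sum_(k <- fset_set A) v k *: delta k) t =
    if t \in A then 0 else v t.
  rewrite l2_valD l2_valN l2_val_sum.
  under eq_bigr do rewrite l2_valZ.
  case: ifPn => tA.
    rewrite (bigD1_seq t) ?fset_uniq//=; last by rewrite in_fset_set.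
    rewrite big1 ?addr0; first by rewrite deltaE eqxx mulr1 subrr.
    by move=> k kt; rewrite deltaE eq_sym (negbTE kt) mulr0.
  rewrite big_seq big1 ?subr0// => k; rewrite in_fset_set// => kA.
  rewrite deltaE; case: eqP => [tk|_]; last by rewrite mulr0.
  by move: tA; rewrite tk kA.
rewrite !setTI [X in (X + _)%E]esum1 ?add0e; last first.
  by move=> t At; rewrite coord mem_set// Normc.normc0 expr0n.
by apply: le_esum => t At; rewrite coord memNset.
Qed.

End l2_basis.

(** * Fields of l^2 vectors over the plane *)

Lemma EFin_sqr_ge0 (R : realType) (x : R) : (0 <= (x ^+ 2)%:E)%E.
Proof. by rewrite lee_fin sqr_ge0. Qed.
#[local] Hint Resolve EFin_sqr_ge0 : core.

Section fields.
Variables (R : realType) (mu : spectral_measures R).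
Local Notation C := (complex_plane R).
Implicit Types (F G : l2_fields R) (E : set C).

(** Measurability of all the coordinates of a field. *)
Definition measurable_field F := forall j k,
  measurable_fun [set: C] (fun z => F j z k : C).

(** The product of a field by a scalar function. *)
Definition mul_field (phi : C -> R[i]) F : l2_fields R :=
  fun j z => phi z *: F j z.

(** The pointwise sum of two fields. *)
Definition add_field F G : l2_fields R := fun j z => F j z + G j z.

(** The characteristic function of a set, with complex values. *)
Definition cindic E : C -> R[i] := fun z => (\1_E z : R)%:C%C.

Lemma L2_field_measurable F : L2_field mu F -> measurable_field F.
Proof. by case. Qed.

Lemma measurable_field_sqr F j k : measurable_field F ->
  measurable_fun [set: C] (fun z => (Normc.normc (F j z k) ^+ 2)%:E).
Proof. by move=> mF; apply/measurable_EFinP; exact: measurable_sqr_normc. Qed.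

Lemma measurable_mul_field (phi : C -> C) F : measurable_fun setT phi ->
  measurable_field F -> measurable_field (mul_field phi F).
Proof. by move=> mphi mF j k; exact: (measurable_complexM mphi (mF j k)). Qed.

Lemma measurable_add_field F G :
  measurable_field F -> measurable_field G -> measurable_field (add_field F G).
Proof. by move=> mF mG j k; exact: (measurable_complexD (mF j k) (mG j k)). Qed.

Lemma measurable_cindic E : measurable E ->
  measurable_fun setT (cindic E : C -> C).
Proof. by move=> mE; apply: measurable_complex_real; exact: measurable_indic. Qed.

Lemma sqr_normc_cindic E z (a : R[i]) :
  Normc.normc (cindic E z * a) ^+ 2 = \1_E z * Normc.normc a ^+ 2.
Proof.
rewrite Normc.normcM exprMn /cindic; congr (_ * _).
by rewrite indicE; case: (z \in E);
  rewrite ?Normc.normc1 ?Normc.normc0 ?expr1n ?expr0n.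
Qed.

Lemma ae_eq_field_refl F : ae_eq_field mu F F.
Proof. by move=> j; exact: aeW. Qed.

Lemma ae_eq_field_sym F G : ae_eq_field mu F G -> ae_eq_field mu G F.
Proof. by move=> FG j; apply: filterS (FG j) => z ->. Qed.

Lemma ae_eq_field_trans G F K :
  ae_eq_field mu F G -> ae_eq_field mu G K -> ae_eq_field mu F K.
Proof. by move=> FG GK j; apply: filterS2 (FG j) (GK j) => z -> ->. Qed.

Lemma ae_eq_mul_field phi F G :
  ae_eq_field mu F G -> ae_eq_field mu (mul_field phi F) (mul_field phi G).
Proof. by move=> FG j; apply: filterS (FG j) => z; rewrite /mul_field => ->. Qed.

Lemma ae_eq_add_field F F' G G' : ae_eq_field mu F F' -> ae_eq_field mu G G' ->
  ae_eq_field mu (add_field F G) (add_field F' G').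
Proof.
move=> FF' GG' j; apply: filterS2 (FF' j) (GG' j) => z.
by rewrite /add_field => -> ->.
Qed.

Lemma eq_field_sqnorm F G : measurable_field F -> measurable_field G ->
  ae_eq_field mu F G -> field_sqnorm mu F = field_sqnorm mu G.
Proof.
move=> mF mG FG; apply: eq_esum => j _; apply: eq_esum => k _.
apply: ge0_ae_eq_integral => //; [exact: measurable_field_sqr..|].
by apply: filterS (FG j) => z -> _.
Qed.

Lemma le_field_sqnorm F G : measurable_field F -> measurable_field G ->
  (forall j, {ae mu j, forall z, forall k,
    Normc.normc (F j z k) ^+ 2 <= Normc.normc (G j z k) ^+ 2}) ->
  (field_sqnorm mu F <= field_sqnorm mu G)%E.
Proof.
move=> mF mG FG; apply: le_esum => j _; apply: le_esum => k _.
apply: ae_ge0_le_integral => //; [exact: measurable_field_sqr..|].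
by apply: filterS (FG j) => z FGz _; rewrite lee_fin.
Qed.

Lemma field_sqnormD F G : measurable_field F -> measurable_field G ->
  (field_sqnorm mu F + field_sqnorm mu G = \esum_(j in [set: multiplicity])
    \esum_(k in [set: Omega j]) \int[mu j]_z
      (Normc.normc (F j z k) ^+ 2 + Normc.normc (G j z k) ^+ 2)%:E)%E.
Proof.
move=> mF mG; rewrite /field_sqnorm -esumD; last 2 first.
- by move=> j _; apply: esum_ge0 => k _; apply: integral_ge0.
- by move=> j _; apply: esum_ge0 => k _; apply: integral_ge0.
apply: eq_esum => j _; rewrite -esumD; last 2 first.
- by move=> k _; apply: integral_ge0.
- by move=> k _; apply: integral_ge0.
apply: eq_esum => k _; rewrite -ge0_integralD//; exact: measurable_field_sqr.
Qed.

(** A quadratic identity between fields, integrated. *)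
Lemma field_sqnorm_identity F G F' G' :
  measurable_field F -> measurable_field G ->
  measurable_field F' -> measurable_field G' ->
  (forall j z k, Normc.normc (F j z k) ^+ 2 + Normc.normc (G j z k) ^+ 2 =
    Normc.normc (F' j z k) ^+ 2 + Normc.normc (G' j z k) ^+ 2) ->
  (field_sqnorm mu F + field_sqnorm mu G =
   field_sqnorm mu F' + field_sqnorm mu G')%E.
Proof.
move=> mF mG mF' mG' FG; rewrite !field_sqnormD//.
apply: eq_esum => j _; apply: eq_esum => k _; apply: eq_integral => z _.
by rewrite FG.
Qed.

(** The norm of the restriction of a field to a Borel set which only [mu j]
    charges. *)
Lemma field_sqnorm_cindic j E F : measurable E -> measurable_field F ->
  (forall i, i <> j -> mu i E = 0%E) ->
  field_sqnorm mu (mul_field (cindic E) F) =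
  (\int[mu j]_(z in E) sqnorm (F j z))%E.
Proof.
move=> mE mF E0.
have term i (k : Omega i) : (\int[mu i]_z
    (Normc.normc (mul_field (cindic E) F i z k) ^+ 2)%:E =
    \int[mu i]_(z in E) (Normc.normc (F i z k) ^+ 2)%:E)%E.
  rewrite [RHS]integral_mkcond; apply: eq_integral => z _.
  rewrite /mul_field l2_valZ sqr_normc_cindic indicE patchE.
  by case: (z \in E); rewrite ?mul1r ?mul0r.
rewrite /field_sqnorm.
under eq_esum => i _ do under eq_esum => k _ do rewrite term.
rewrite (esumID [set j])//; last first.
  by move=> i _; apply: esum_ge0 => k _; apply: integral_ge0.
rewrite [X in (_ + X)%E]esum1 ?adde0 ?setTI; last first.
  move=> i /= ij; apply: esum1 => k _.
  rewrite (@null_set_integral _ _ _ (mu i) E)//; last exact: E0.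
    by apply: (measurable_funS measurableT) => //; exact: measurable_field_sqr.
rewrite esum_set1; last by apply: esum_ge0 => k _; apply: integral_ge0.
by rewrite /sqnorm integral_esum// => k; exact: measurable_field_sqr.
Qed.

Lemma measurable_sqnorm F j : measurable_field F ->
  measurable_fun setT (fun z => sqnorm (F j z)).
Proof.
by move=> mF; apply: measurable_esum => // k; exact: measurable_field_sqr.
Qed.

(** Dominated convergence in the direct sum of the L^2 spaces. *)
Lemma field_sqnorm_cvg0 (phi : nat -> C -> C) (c : R) F :
  (forall n, measurable_fun setT (phi n)) -> L2_field mu F ->
  (forall j, {ae mu j, forall z, forall n,
    Normc.normc (phi n z : R[i]) ^+ 2 <= c}) ->
  (forall j, {ae mu j, forall z,
    (fun n => Normc.normc (phi n z : R[i]) ^+ 2) @ \oo --> (0 : R)}) ->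
  (fun n => field_sqnorm mu (mul_field (phi n) F)) @ \oo --> 0%E.
Proof.
move=> mphi [mF Foo] phic phi0.
have m2 n j k : measurable_fun setT (fun z =>
    (Normc.normc (mul_field (phi n) F j z k) ^+ 2)%:E).
  by apply: measurable_field_sqr; exact: measurable_mul_field.
pose g j k := (\int[mu j]_z (`|c|%:E * (Normc.normc (F j z k) ^+ 2)%:E))%E.
have g0 j k : (0 <= g j k)%E.
  by apply: integral_ge0 => z _; rewrite mule_ge0// lee_fin.
have gE j k : g j k = (`|c|%:E * \int[mu j]_z (Normc.normc (F j z k) ^+ 2)%:E)%E.
  by rewrite /g ge0_integralZl_EFin//; exact: measurable_field_sqr.
have sg : (\esum_(j in [set: multiplicity])
    \esum_(k in [set: Omega j]) g j k < +oo)%E.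
  apply: (@le_lt_trans _ _ (`|c|%:E * field_sqnorm mu F)%E); last first.
    by rewrite lte_mul_pinfty// lee_fin.
  apply: le_trans (esumZ_le _ _) => //; last first.
    by move=> j; apply: esum_ge0 => k _; apply: integral_ge0.
  apply: le_esum => j _; apply: le_trans (esumZ_le _ _) => //; last first.
    by move=> k; apply: integral_ge0.
  by apply: le_esum => k _; rewrite gE.
have fg n j k : (\int[mu j]_z (Normc.normc (mul_field (phi n) F j z k) ^+ 2)%:E
    <= g j k)%E.
  apply: ae_ge0_le_integral => //.
  - by move=> z _; rewrite mule_ge0// lee_fin.
  - by apply: measurable_funeM; exact: measurable_field_sqr.
  apply: filterS (phic j) => z /(_ n) cz _.
  rewrite -EFinM lee_fin /mul_field l2_valZ Normc.normcM exprMn.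
  by rewrite ler_wpM2r ?sqr_ge0// (le_trans cz)// ler_norm.
have sgj j : (\esum_(k in [set: Omega j]) g j k < +oo)%E.
  apply: le_lt_trans sg; apply: esum_ge; exists [set j].
    by split => //; exact: finite_set1.
  by rewrite fsbig_set1.
apply: (esum_cvg0 (g := fun j => \esum_(k in [set: Omega j]) g j k)%E) => //.
- by move=> n j; apply: esum_ge0 => k _; apply: integral_ge0.
- by move=> n j; apply: le_esum.
move=> j; apply: (esum_cvg0 (g := g j)) => //.
- by move=> n k; apply: integral_ge0.
move=> k; rewrite -(integral0 (mu j) setT).
have phiF_cvg : {ae mu j, forall z, setT z -> (fun n =>
    (Normc.normc (mul_field (phi n) F j z k) ^+ 2)%:E) @ \oo --> 0%E}.
  apply: filterS (phi0 j) => z phiz _.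
  apply/cvg_EFin; first exact: nearW.
  rewrite [X in X @ _](_ : _ = fun n =>
    Normc.normc (phi n z : R[i]) ^+ 2 * Normc.normc (F j z k) ^+ 2).
    by rewrite -(mul0r (Normc.normc (F j z k) ^+ 2)); exact: cvgMr_tmp.
  by apply/funext => n /=; rewrite /mul_field l2_valZ Normc.normcM exprMn.
have ig : (mu j).-integrable setT
    (fun z => (`|c|%:E * (Normc.normc (F j z k) ^+ 2)%:E)%E).
  apply/integrableP; split.
    by apply: measurable_funeM; exact: measurable_field_sqr.
  under eq_integral => z _ do rewrite gee0_abs ?mule_ge0 ?lee_fin ?sqr_ge0//.
  apply: le_lt_trans (sgj j); apply: esum_ge; exists [set k].
    by split => //; exact: finite_set1.
  by rewrite fsbig_set1.
have phiF_le : {ae mu j, forall z, forall n, setT z ->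
    (`|(Normc.normc (mul_field (phi n) F j z k) ^+ 2)%:E| <=
     `|c|%:E * (Normc.normc (F j z k) ^+ 2)%:E)%E}.
  apply: filterS (phic j) => z cz n _.
  rewrite -EFinM gee0_abs ?lee_fin ?sqr_ge0// /mul_field l2_valZ Normc.normcM.
  by rewrite exprMn ler_wpM2r ?sqr_ge0// (le_trans (cz n))// ler_norm.
by have [] := dominated_convergence measurableT (fun n => m2 n j k)
  (measurable_cst 0%E) phiF_cvg ig phiF_le.
Qed.

End fields.

(** * Orthogonal projections in a Hilbert space *)

Section hilbert.
Variables (R : realType) (H : completeNormedModType R[i]).
Variable dot : {dot H for Num.conj}.
Hypothesis norm_dot : forall x : H, `|x| ^+ 2 = dot x x.
Implicit Types (x y z v w : H) (V : set H).

Lemma dotC x y : dot x y = (dot y x)^*%C.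
Proof. by rewrite hermC expr0 mul1r. Qed.

Lemma dotDl x y z : dot (x + y) z = dot x z + dot y z.
Proof. exact: linearDl. Qed.

Lemma dotDr x y z : dot x (y + z) = dot x y + dot x z.
Proof. exact: linearDr. Qed.

Lemma dotZl (a : R[i]) x y : dot (a *: x) y = a * dot x y.
Proof. exact: linearZl_LR. Qed.

Lemma dotZr (a : R[i]) x y : dot x (a *: y) = a^*%C * dot x y.
Proof. exact: linearZr_LR. Qed.

Lemma dotNr x y : dot x (- y) = - dot x y.
Proof. exact: linearNr. Qed.

Lemma rnorm_sqr x : (rnorm x ^+ 2)%:C%C = dot x x.
Proof. by rewrite rmorphXn/= -rnormE norm_dot. Qed.

Lemma rnormD_sqr x y :
  rnorm (x + y) ^+ 2 = rnorm x ^+ 2 + rnorm y ^+ 2 + 2 * complex.Re (dot x y).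
Proof.
have : complex.Re ((rnorm (x + y) ^+ 2)%:C%C) = rnorm (x + y) ^+ 2 by [].
move=> <-; rewrite rnorm_sqr dotDl !dotDr -!rnorm_sqr (dotC y x) !raddfD/=.
by case: (dot x y) => a b /=; ring.
Qed.

Lemma dot_i x y : complex.Re (dot x ('i%C *: y)) = complex.Im (dot x y).
Proof. by rewrite dotZr/=; case: (dot x y) => a b /=; ring. Qed.

Lemma Re_dotN x y : complex.Re (dot x (- y)) = - complex.Re (dot x y).
Proof. by rewrite dotNr raddfN. Qed.

Lemma Re_dotZ x y (t : R) :
  complex.Re (dot x (t%:C%C *: y)) = t * complex.Re (dot x y).
Proof. by rewrite dotZr/=; case: (dot x y) => a b /=; ring. Qed.

Lemma dot_eq0 x y : complex.Re (dot x y) = 0 ->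
  complex.Re (dot x ('i%C *: y)) = 0 -> dot x y = 0.
Proof. by rewrite dot_i; case: (dot x y) => a b /= -> ->. Qed.

Lemma Re_dot_le x y : complex.Re (dot x y) <= rnorm x * rnorm y.
Proof.
have : rnorm (x + y) ^+ 2 <= (rnorm x + rnorm y) ^+ 2.
  by rewrite ler_pXn2r// ?nnegrE ?addr_ge0 ?rnorm_ge0//; exact: rnormD_le.
by rewrite rnormD_sqr sqrrD; lra.
Qed.

Lemma parallelogram x y :
  rnorm (x + y) ^+ 2 + rnorm (x - y) ^+ 2 = 2 * rnorm x ^+ 2 + 2 * rnorm y ^+ 2.
Proof. by rewrite !rnormD_sqr Re_dotN rnormN; ring. Qed.

Lemma closed_orthogonal_complement V :
  closed_subspace (orthogonal_complement dot V).
Proof.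
split => [x xV y Vy| |a x y xV yV z Vz]; last 2 first.
- by move=> y _; rewrite linear0l.
- by rewrite dotDl dotZl xV// yV//= mulr0 addr0.
have small w : (forall z, orthogonal_complement dot V z -> dot z w = 0) ->
    complex.Re (dot x w) <= 0.
  move=> zw; apply/ler_addgt0Pl => e e0; rewrite addr0.
  have w1 : 0 < rnorm w + 1 by rewrite ltr_wpDl// rnorm_ge0.
  have [z zV xz] := (closure_rnormP _ _).1 xV _ (divr_gt0 e0 w1).
  rewrite -[x](subrK z) dotDl (zw z)// addr0 (le_trans (Re_dot_le _ _))//.
  apply: (@le_trans _ _ (rnorm (x - z) * (rnorm w + 1))).
    by rewrite ler_wpM2l ?rnorm_ge0// lerDl.
  by rewrite -ler_pdivlMr// ltW.
have Re0 w : (forall z, orthogonal_complement dot V z -> dot z w = 0) ->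
    complex.Re (dot x w) = 0.
  move=> zw; apply/eqP; rewrite eq_le small//= -oppr_le0 -Re_dotN small// => z zV.
  by rewrite dotNr zw// oppr0.
apply: dot_eq0; apply: Re0 => z zV; first exact: zV.
by rewrite dotZr zV// /= mulr0.
Qed.

(** A vector which cannot be shortened by adding elements of a subspace is
    orthogonal to it. *)
Lemma minimal_orthogonal x V : closed_subspace V ->
  (forall w, V w -> rnorm x <= rnorm (x + w)) -> orthogonal_complement dot V x.
Proof.
move=> Vsub xmin w Vw.
have Re0 v : V v -> complex.Re (dot x v) = 0.
  move=> Vv; set r := complex.Re _.
  have [ve0|v0] := eqVneq v 0; first by rewrite /r ve0 linear0r.
  have n0 : 0 < rnorm v ^+ 2.
    rewrite exprn_gt0// lt_def rnorm_ge0 andbT.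
    by apply: contra_neq v0; exact: rnorm_eq0.
  (* The multiple of [v] which shortens [x] the most. *)
  have := xmin _ (closed_subspaceZ (- r / rnorm v ^+ 2)%:C%C Vsub Vv).
  rewrite -(@ler_pXn2r _ 2) ?nnegrE ?rnorm_ge0// rnormD_sqr Re_dotZ -/r.
  have -> : rnorm ((- r / rnorm v ^+ 2)%:C%C *: v) ^+ 2 = r ^+ 2 / rnorm v ^+ 2.
    rewrite rnormZ exprMn sqr_normcE /= expr0n/= addr0.
    by field; move: n0; rewrite lt_def => /andP[]; rewrite sqrf_eq0.
  have -> : rnorm x ^+ 2 + r ^+ 2 / rnorm v ^+ 2 + 2 * (- r / rnorm v ^+ 2 * r) =
     rnorm x ^+ 2 - r ^+ 2 / rnorm v ^+ 2 by ring.
  rewrite lerBrDl gerDr pmulr_lle0 ?invr_gt0// => r0.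
  by apply/eqP; rewrite -sqrf_eq0 eq_le r0 sqr_ge0.
by apply: dot_eq0; apply: Re0 => //; exact: closed_subspaceZ.
Qed.

(** The orthogonal projection onto a closed subspace. *)
Lemma projection_exists V x : closed_subspace V ->
  exists2 v, V v & orthogonal_complement dot V (x - v).
Proof.
move=> Vsub; have [Vcl V0 Vlin] := Vsub.
pose D := [set rnorm (x - v) ^+ 2 | v in V].
have D0 : has_inf D.
  split; first by exists (rnorm (x - 0) ^+ 2); exists 0.
  by exists 0 => _ [v _ <-]; rewrite sqr_ge0.
set d := inf D.
have dD v : V v -> d <= rnorm (x - v) ^+ 2.
  by move=> Vv; apply: ge_inf; [exact: D0.2|exists v].
have /choice[v vP] : forall n : nat, exists v,
    V v /\ rnorm (x - v) ^+ 2 < d + n.+1%:R^-1.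
  move=> n; have n0 : 0 < n.+1%:R^-1 :> R by rewrite invr_gt0.
  by have [_ [v Vv <-] vd] := inf_adherent n0 D0; exists v.
(* The midpoint of [v m] and [v n] lies in [V], so that the parallelogram
   identity makes the minimizing sequence [v] a Cauchy sequence. *)
have vm m n : rnorm (v m - v n) ^+ 2 <= 2 * (m.+1%:R^-1 + n.+1%:R^-1).
  have [Vm dm] := vP m; have [Vn dn] := vP n.
  have := parallelogram (x - v n) (x - v m).
  have -> : (x - v n) - (x - v m) = v m - v n by rewrite opprB addrC addrA subrK.
  rewrite [X in rnorm X ^+ 2 + _](_ : _ =
      2%:C%C *: (x - 2^-1%:C%C *: (v m + v n))); last first.
    rewrite scalerBr scalerA -rmorphM/= divff// scale1r.
    by rewrite rmorphMn/= scaler_nat mulr2n opprD [- v m - _]addrC addrACA.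
  rewrite rnormZ exprMn sqr_normcE/= expr0n addr0.
  have := dD _ (closed_subspaceZ 2^-1%:C%C Vsub (closed_subspaceD Vsub Vm Vn)).
  move: dm dn; move: m.+1%:R^-1 n.+1%:R^-1 => p q; lra.
have cv : cvgn v.
  apply/cauchy_cvgP/cauchy_ballP => e /posc[r r0 ->].
  have N0 : 0 < r ^+ 2 / 4 by rewrite divr_gt0 ?exprn_gt0.
  have [N _ Nr] := near_infty_natSinv_lt (PosNum N0).
  pose T := [set v n | n in [set n | (N <= n)%N]].
  exists (T, T); first by split; exists N => // n Nn; exists n.
  move=> [_ _] [/= [m /Nr/= mr <-] [n /Nr/= nr <-]].
  rewrite -ball_normE/= rnormE ltcR.
  rewrite -(@ltr_pXn2r _ 2) ?nnegrE ?rnorm_ge0 ?(ltW r0)//.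
  apply: le_lt_trans (vm m n) _.
  by move: mr nr; move: m.+1%:R^-1 n.+1%:R^-1 => p q; lra.
have Vl : V (limn v).
  by apply: closed_cvg cv => //; apply: nearW => n; case: (vP n).
exists (limn v) => //; apply: minimal_orthogonal => // w Vw.
have rcv : (fun n => rnorm (x - v n)) @ \oo --> rnorm (x - limn v).
  apply/cvgrPdist_lt => e e0.
  have eC : 0 < e%:C%C :> R[i] by rewrite ltcR.
  have /cvgrPdist_lt/(_ _ eC) := cv; apply: filterS => n.
  rewrite rnormE ltcR; apply: le_lt_trans.
  have lip (a b : H) : rnorm a - rnorm b <= rnorm (a - b).
    by rewrite lerBlDr -[a in leLHS](subrK b) rnormD_le.
  rewrite ler_norml; apply/andP; split.
    rewrite lerNl opprB (le_trans (lip _ _))//.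
    by rewrite opprB addrC addrA subrK.
  rewrite (le_trans (lip _ _))//.
  by rewrite -rnormN !opprB addrC addrA subrK.
have xld : rnorm (x - limn v) ^+ 2 <= d.
  have c1 : (fun n => rnorm (x - v n) ^+ 2) @ \oo --> rnorm (x - limn v) ^+ 2.
    by under eq_fun do rewrite expr2; rewrite expr2; exact: cvgM.
  have c2 : (fun n => d + n.+1%:R^-1) @ \oo --> d + 0.
    by apply: cvgD; [exact: cvg_cst|exact: cvg_harmonic].
  rewrite addr0 in c2; apply: ler_cvg_to c1 c2 _.
  by apply: nearW => n; case: (vP n) => _ /ltW.
rewrite -(@ler_pXn2r _ 2) ?nnegrE ?rnorm_ge0//; apply: le_trans xld _.
rewrite (_ : x - limn v + w = x - (limn v - w)); last first.
  by rewrite opprB addrA addrAC.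
apply: dD.
by rewrite addrC -scaleN1r; exact: Vlin.
Qed.

Lemma orthogonal_complement_trivial V : closed_subspace V ->
  (forall x, orthogonal_complement dot V x -> x = 0) -> V = setT.
Proof.
move=> Vsub V0; apply/seteqP; split=> // x _.
have [v Vv /V0/eqP] := projection_exists x Vsub.
by rewrite subr_eq0 => /eqP ->.
Qed.

End hilbert.

(** * Vectors in the spectral representation *)

Section single_component.
Variables (R : realType) (mu : spectral_measures R) (j : multiplicity).
Local Notation C := (complex_plane R).
Implicit Types h : C -> l2 R (Omega j).

(** The field whose only nonzero component is the [j]-th one, equal to [h]. The
    type of the values depends on the component, whence the transport along the
    equality of indices. *)
Definition single_field h : l2_fields R := fun i z =>
  if eqP is ReflectT ji then ecast i (l2 R (Omega i)) ji (h z)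
  else 0 : l2 R (Omega i).

Arguments single_field : clear implicits.

Lemma single_fieldE h z : single_field h j z = h z.
Proof. by rewrite /single_field; case: eqP => // e; rewrite eq_axiomK. Qed.

Lemma single_fieldN h i z : i <> j -> single_field h i z = 0.
Proof. by rewrite /single_field => ij; case: eqP => // ji; case: ij. Qed.

Lemma measurable_single_field h :
  (forall k, measurable_fun setT (fun z => h z k : C)) ->
  measurable_field (single_field h).
Proof.
move=> mh i; rewrite /single_field; case: eqP => [ji|_] k.
  by move: k; case: _ / ji => k; exact: mh.
exact: measurable_cst.
Qed.

Lemma field_sqnorm_single h :
  (forall k, measurable_fun setT (fun z => h z k : C)) ->
  field_sqnorm mu (single_field h) = (\int[mu j]_z sqnorm (h z))%E.
Proof.
move=> mh; rewrite /field_sqnorm (esumID [set j]); last first.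
  by move=> i _; apply: esum_ge0 => k _; apply: integral_ge0.
rewrite [X in (_ + X)%E]esum1 ?adde0 ?setTI; last first.
  move=> i /= ij; apply: esum1 => k _; apply: integral0_eq => z _.
  by rewrite single_fieldN// l2_val0 Normc.normc0 expr0n.
rewrite esum_set1; last first.
  by apply: esum_ge0 => k _; apply: integral_ge0.
rewrite /sqnorm integral_esum//; last first.
  by move=> k; apply/measurable_EFinP; exact: measurable_sqr_normc.
by apply: eq_esum => k _; apply: eq_integral => z _; rewrite single_fieldE.
Qed.

End single_component.

Section unitary_representation.
Variables (R : realType) (H : normedModType R[i]) (mu : spectral_measures R).
Variable U : H -> l2_fields R.
Hypothesis unitaryU : unitary_onto_L2 mu U.
Local Notation C := (complex_plane R).
Implicit Types (x y : H) (F G : l2_fields R) (j : multiplicity).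

Lemma U_L2 x : L2_field mu (U x). Proof. by case: unitaryU => + _ _ _; apply. Qed.

Lemma U_measurable x : measurable_field (U x).
Proof. exact: L2_field_measurable (U_L2 x). Qed.

Lemma U_norm x : field_sqnorm mu (U x) = (rnorm x ^+ 2)%:E.
Proof. by case: unitaryU => _ _ + _; apply. Qed.

Lemma U_onto F : L2_field mu F -> exists x, ae_eq_field mu (U x) F.
Proof. by case: unitaryU => _ _ _; apply. Qed.

Lemma U_lin (a : R[i]) x y :
  ae_eq_field mu (U (a *: x + y)) (add_field (mul_field (fun=> a) (U x)) (U y)).
Proof. by case: unitaryU => _ + _ _; apply. Qed.

Lemma rnorm_field x F : measurable_field F -> ae_eq_field mu (U x) F ->
  field_sqnorm mu F = (rnorm x ^+ 2)%:E.
Proof.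
by move=> mF xF; rewrite -U_norm; apply: eq_field_sqnorm (ae_eq_field_sym xF) => //;
  exact: U_measurable.
Qed.

Lemma U_D x y : ae_eq_field mu (U (x + y)) (add_field (U x) (U y)).
Proof.
have := U_lin 1 x y; rewrite scale1r => /ae_eq_field_trans; apply => j.
by apply: aeW => z; rewrite /add_field /mul_field scale1r.
Qed.

Lemma U_0 : ae_eq_field mu (U 0) (fun j z => 0).
Proof.
have := U_lin (-1) 0 0; rewrite scaleN1r oppr0 add0r => U0 j.
apply: filterS (U0 j) => z; rewrite /add_field /mul_field => ->.
by rewrite scaleN1r addNr.
Qed.

Lemma U_Z (a : R[i]) x : ae_eq_field mu (U (a *: x)) (mul_field (fun=> a) (U x)).
Proof.
have := U_lin a x 0; rewrite addr0 => Ua j.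
by apply: filterS2 (Ua j) (U_0 j) => z ->; rewrite /add_field => ->; rewrite addr0.
Qed.

Lemma U_B x y :
  ae_eq_field mu (U (x - y)) (add_field (U x) (mul_field (fun=> -1) (U y))).
Proof.
apply: ae_eq_field_trans (U_D _ _) _; rewrite -scaleN1r.
by apply: ae_eq_add_field; [exact: ae_eq_field_refl|exact: U_Z].
Qed.

Lemma U_inj0 x : (forall j, {ae mu j, forall z, U x j z = 0}) -> x = 0.
Proof.
move=> x0; apply: rnorm_eq0; apply/eqP; rewrite -sqrf_eq0 -eqe -U_norm.
have m0 : measurable_field (fun (j : multiplicity) (z : C) => 0 : l2 R (Omega j)).
  by move=> j k; exact: measurable_cst.
rewrite (eq_field_sqnorm (U_measurable x) m0 x0).
apply/eqP/esum1 => j _; apply: esum1 => k _; apply: integral0_eq => z _.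
by rewrite l2_val0 Normc.normc0 expr0n.
Qed.

Lemma integral_sqnorm_le x j :
  (\int[mu j]_z sqnorm (U x j z) <= (rnorm x ^+ 2)%:E)%E.
Proof.
rewrite -U_norm /sqnorm integral_esum//; last first.
  by move=> k; exact: measurable_field_sqr (U_measurable x).
apply: esum_ge; exists [set j]; first by split => //; exact: finite_set1.
by rewrite fsbig_set1.
Qed.

(** Approximation in norm yields, at almost every point, approximation of the
    values; Chebyshev's inequality. *)
Lemma ae_approximation (S : set H) x j : closure S x ->
  {ae mu j, forall z, forall e : R, 0 < e ->
    exists2 y, S y & sq (U (x - y) j z) < e}.
Proof.
move=> /closure_rnormP xS.
have /choice[y yP] : forall m : nat, exists y,
    S y /\ rnorm (x - y) ^+ 2 < m.+1%:R^-1.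
  move=> m; have m0 : 0 < m.+1%:R^-1 :> R by rewrite invr_gt0.
  have [y Sy xy] := xS _ m0; exists y; split => //; apply: le_lt_trans (xy).
  rewrite expr2 ler_piMl ?rnorm_ge0// (le_trans (ltW xy))//.
  by rewrite invf_le1// ler1n.
have mn m : measurable_fun setT (fun z => sqnorm (U (x - y m)%R j z)).
  by apply: measurable_sqnorm; exact: U_measurable.
(* By Chebyshev's inequality, the set where all the [y m] stay away from [x]
   by a fixed amount is negligible. *)
pose B (n m : nat) := [set z | (n.+1%:R^-1%:E <= sqnorm (U (x - y m)%R j z))%E].
have mB n m : measurable (B n m).
  rewrite -[B n m]setTI; apply: emeasurable_fun_c_infty => //.
pose BB n := \bigcap_m B n m.
have mBB n : measurable (BB n) by exact: bigcapT_measurable.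
have B0 n : mu j (BB n) = 0%E.
  have le m : (n.+1%:R^-1%:E * mu j (BB n) <= m.+1%:R^-1%:E)%E.
    apply: (@le_trans _ _ (\int[mu j]_(z in BB n) n.+1%:R^-1%:E)%E).
      by rewrite (integral_cst (mu j) (mBB n)  (n.+1%:R^-1)%:E).
    apply: (@le_trans _ _ (\int[mu j]_(z in BB n) sqnorm (U (x - y m)%R j z))%E).
      apply: ge0_le_integral => //.
      - exact: measurable_funTS.
      - by move=> z /(_ m I).
    apply: (@le_trans _ _ (\int[mu j]_z sqnorm (U (x - y m)%R j z))%E).
      by apply: ge0_subset_integral => // z _; exact: sqnorm_ge0.
    apply: le_trans (integral_sqnorm_le _ _) _.
    by rewrite lee_fin ltW//; case: (yP m).
  have fin : mu j (BB n) \is a fin_num by rewrite fin_num_measure.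
  apply/eqP; rewrite eq_le measure_ge0 andbT -(fineK fin) lee_fin.
  apply/ler_addgt0Pl => e e0; rewrite addr0.
  have e1 : 0 < n.+1%:R^-1 * e :> R by rewrite mulr_gt0// invr_gt0.
  have [N _ /(_ N (leqnn N)) /= Ne] := near_infty_natSinv_lt (PosNum e1).
  have := le N; rewrite -(fineK fin) -EFinM lee_fin => h.
  have := le_lt_trans h Ne; rewrite ltr_pM2l ?invr_gt0// => /ltW; exact.
have : {ae mu j, forall z, forall n, ~ (BB n) z}.
  apply: ae_foralln => n; exists (BB n); split; [exact: mBB|exact: B0|].
  by move=> z /= /contrapT.
apply: filterS => z Bz e e0.
have [N _ /(_ N (leqnn N)) /= Ne] := near_infty_natSinv_lt (PosNum e0).
have /existsNP[m /not_implyP[_ Bm]] := Bz N.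
exists (y m); first by case: (yP m).
apply: lt_trans Ne; rewrite ltNge; apply/negP => h; apply: Bm.
by rewrite /B/= -sqE lee_fin.
Qed.

End unitary_representation.

(** * Completeness of the fibres *)

Section fibres.
Variables (R : realType) (H : normedModType R[i]) (mu : spectral_measures R).
Variables (U : H -> l2_fields R) (A : {linear H -> H}).
Hypothesis unitaryU : unitary_onto_L2 mu U.
Hypothesis UA : forall x, ae_eq_field mu (U (A x)) (mul_field id (U x)).
Local Notation C := (complex_plane R).
Implicit Types (x y : H) (F : l2_fields R) (G : set H) (j : multiplicity).

Lemma U_iter n x :
  ae_eq_field mu (U (iter n A x)) (mul_field (fun z => (z : R[i]) ^+ n) (U x)).
Proof.
elim: n => [|n IH] j.
  by apply: aeW => z; rewrite /mul_field expr0 scale1r.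
rewrite iterS; apply: filterS2 (UA (iter n A x) j) (IH j) => z ->.
by rewrite /mul_field => ->; rewrite scalerA -exprS.
Qed.

(** Away from a null set, the values of a vector spanned by the orbits lie in
    the span of the values of the generators. *)
Lemma span_orbit_fibre G x j : Defs.span (orbit_system A G) x ->
  {ae mu j, forall z, Defs.span [set U g j z | g in G] (U x j z)}.
Proof.
move: x; apply: span_sub.
- by apply: filterS (U_0 unitaryU j) => z ->; exact: span0.
- move=> a x y xS yS; move: (U_lin unitaryU a x y j) xS yS; apply: filterS3 => z.
  by rewrite /add_field /mul_field => ->; exact: span_lin.
- move=> _ [g [n [Gg ->]]]; apply: filterS (U_iter n g j) => z ->.
  rewrite /mul_field -[X in Defs.span _ X]addr0; apply: span_lin (span0 _).
  by apply: span_gen; exists g.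
Qed.

Lemma finite_measure_field j (h : C -> l2 R (Omega j)) :
  (forall k, measurable_fun setT (fun z => h z k : C)) ->
  (forall z, (sqnorm (h z) <= 1)%E) -> L2_field mu (single_field h).
Proof.
move=> mh h1; split; first exact: measurable_single_field.
rewrite field_sqnorm_single//.
apply: (@le_lt_trans _ _ (\int[mu j]_z 1%:E)%E).
  apply: ge0_le_integral => //; first by move=> z _; exact: sqnorm_ge0.
  by apply: measurable_esum => [k z|k]; [exact: EFin_sqr_ge0|
    apply/measurable_EFinP; exact: measurable_sqr_normc].
rewrite (integral_cst (mu j) measurableT 1%:E) mul1e.
by rewrite -ge0_fin_numE// fin_num_measure.
Qed.

(** Completeness of the orbits forces completeness of almost all fibres: the
    constant fields given by the standard basis are limits of vectors spanned by
    the orbits, hence almost all fibres contain the standard basis in the closed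
    span of the values of the generators. *)
Lemma complete_fibres G j : complete_system (orbit_system A G) ->
  {ae mu j, forall z, complete_system [set U g j z | g in G]}.
Proof.
move=> cG.
have basis (k : Omega j) : {ae mu j, forall z,
    closure (Defs.span [set U g j z | g in G]) (delta R k)}.
  have [f fk] : exists f, ae_eq_field mu (U f) (single_field (fun=> delta R k)).
    apply: (U_onto unitaryU); apply: finite_measure_field => [i|z].
      exact: measurable_cst.
    by rewrite sqnorm_delta.
  have fS : closure (Defs.span (orbit_system A G)) f by rewrite cG.
  have /closure_rnormP fS' := fS.
  have /choice[x xP] : forall m : nat, exists x, Defs.span (orbit_system A G) x /\
      rnorm (f - x) < m.+1%:R^-1.
    move=> m; have m0 : 0 < m.+1%:R^-1 :> R by rewrite invr_gt0.
    by have [x Sx fx] := fS' _ m0; exists x.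
  have fX : closure (range x) f.
    apply/closure_rnormP => e e0.
    have [N _ /(_ N (leqnn N)) /= Ne] := near_infty_natSinv_lt (PosNum e0).
    by exists (x N); [exists N|apply: lt_trans Ne; case: (xP N)].
  have fx : {ae mu j, forall z, forall m, U (f - x m) j z = U f j z - U (x m) j z}.
    apply: ae_foralln => m; apply: filterS (U_B unitaryU f (x m) j) => z ->.
    by rewrite /add_field /mul_field scaleN1r.
  have xS : {ae mu j, forall z, forall m,
      Defs.span [set U g j z | g in G] (U (x m) j z)}.
    by apply: ae_foralln => m; apply: span_orbit_fibre; case: (xP m).
  apply: filterS (filterI (filterI (fk j) fx)
    (filterI xS (ae_approximation unitaryU j fX))) => z [[fz fxz] [xSz near]].
  apply/closure_rnormP => e e0.
  have [_ [m _ <-] me] := near _ (exprn_gt0 2 e0).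
  exists (U (x m) j z) => //.
  rewrite -(@ltr_pXn2r _ 2) ?nnegrE ?rnorm_ge0 ?(ltW e0)// -sq_rnorm.
  by move: me; rewrite fxz fz single_fieldE.
have : {ae mu j, forall z, forall n, if @pickle_inv (Omega j) n is Some k then
    closure (Defs.span [set U g j z | g in G]) (delta R k) else True}.
  apply: ae_foralln => n; case: pickle_inv => [k|]; first exact: basis.
  exact: aeW.
apply: filterS => z hz; apply: delta_dense => [|k].
  exact: closure_span_subspace.
by have := hz (choice.pickle k); rewrite pickleK_inv.
Qed.

End fibres.

(** * Polynomials converging to the characteristic function of an interval *)

Section threshold.
Variable R : realType.
Implicit Types u t : R.

(** Polynomials in [u] converging boundedly on the unit interval to the
    characteristic function of [u * k < 1]. The factor [n] in the exponent gives
    the limit 0 also when [u * k = 1]. *)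
Definition threshold (k n : nat) u : R := (1 - u ^+ n) ^+ (n * k ^ n).

Lemma bernoulli (x : R) n : 0 <= x -> 1 + n%:R * x <= (1 + x) ^+ n.
Proof.
move=> x0; elim: n => [|n IH]; first by rewrite mul0r addr0 expr0.
rewrite exprS; apply: (@le_trans _ _ ((1 + x) * (1 + n%:R * x))).
  have : 0 <= n%:R * x * x by rewrite !mulr_ge0.
  by rewrite -natr1; lra.
by rewrite ler_wpM2l// addr_ge0.
Qed.

Lemma bernoulli_sub (x : R) n : 0 <= x <= 1 -> 1 - n%:R * x <= (1 - x) ^+ n.
Proof.
move=> /andP[x0 x1]; elim: n => [|n IH]; first by rewrite mul0r subr0 expr0.
rewrite exprS; apply: (@le_trans _ _ ((1 - x) * (1 - n%:R * x))).
  have : 0 <= n%:R * x * x by rewrite !mulr_ge0.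
  by rewrite -natr1; lra.
by rewrite ler_wpM2l// subr_ge0.
Qed.

Lemma cvg_natr_expr t : 0 <= t < 1 ->
  (fun n => n%:R * t ^+ n : R) @ \oo --> (0 : R).
Proof.
move=> /andP[t0 t1]; have [->|tn0] := eqVneq t 0.
  apply: cvg_near_cst; exists 1%N => // -[|n]//= _.
  by rewrite expr0n/= mulr0.
have {tn0 t0} t0 : 0 < t by rewrite lt_def tn0.
(* With [t = s ^+ 2], the factor [n%:R * s ^+ n] is bounded by Bernoulli's
   inequality and the other factor [s ^+ n] tends to 0. *)
pose s := Num.sqrt t.
have s0 : 0 < s by rewrite sqrtr_gt0.
have ss : s ^+ 2 = t by rewrite sqr_sqrtr// ltW.
have s1 : s < 1 by rewrite -(@ltr_pXn2r _ 2) ?nnegrE ?(ltW s0)// ss expr1n.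
have c0 : 0 < s^-1 - 1 by rewrite subr_gt0 invf_gt1.
have bnd n : n%:R * s ^+ n <= (s^-1 - 1)^-1.
  rewrite -ler_pdivlMr ?exprn_gt0// ler_pdivlMl// mulrC -exprVn.
  have := bernoulli n (ltW c0); rewrite [X in X ^+ n]addrC subrK.
  move=> /(le_trans _); apply.
  by rewrite lerDr.
apply: (@squeeze_cvgr _ _ _ _ (fun=> 0) (fun n => (s^-1 - 1)^-1 * s ^+ n)).
- apply: nearW => n; rewrite mulr_ge0// ?exprn_ge0 ?(ltW t0)//=.
  rewrite -ss -exprM mul2n -addnn exprD mulrA ler_wpM2r//.
  by rewrite exprn_ge0// ltW.
- exact: cvg_cst.
- rewrite -[X in _ --> X](mulr0 (s^-1 - 1)^-1); apply: cvgMl_tmp.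
  by apply: cvg_expr; rewrite ger0_norm// ltW.
Qed.

Lemma threshold_itv k n u : 0 <= u <= 1 -> 0 <= threshold k n u <= 1.
Proof.
move=> /andP[u0 u1]; rewrite /threshold.
have un : 0 <= u ^+ n <= 1 by rewrite exprn_ge0//= exprn_ile1.
by rewrite exprn_ge0 ?exprn_ile1//; lra.
Qed.

Lemma threshold_cvg k u : 0 <= u <= 1 ->
  (fun n => threshold k n u) @ \oo --> (if u * k%:R < 1 then 1 else 0 : R).
Proof.
move=> u01; have [u0 u1] := andP u01.
have un n : 0 <= u ^+ n <= 1 by rewrite exprn_ge0//= exprn_ile1.
have E n : (n * k ^ n)%:R * u ^+ n = n%:R * (u * k%:R) ^+ n.
  by rewrite natrM natrX exprMn -!mulrA [u ^+ n * _]mulrC.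
have [uk|uk] := ltP (u * k%:R) 1.
  apply: (@squeeze_cvgr _ _ _ _ (fun n => 1 - n%:R * (u * k%:R) ^+ n) (fun=> 1)).
  - apply: nearW => n; rewrite -E bernoulli_sub//=.
    by have /andP[] := threshold_itv k n u01.
  - rewrite -[X in _ --> X](subr0 (1 : R)); apply: cvgB; first exact: cvg_cst.
    by apply: cvg_natr_expr; rewrite uk mulr_ge0.
  - exact: cvg_cst.
apply: (@squeeze_cvgr _ _ _ _ (fun=> 0) (fun n => n.+1%:R^-1)).
- apply: nearW => n; have /andP[-> _] /= := threshold_itv k n u01.
  have [a0 a1] := andP (un n).
  have P0 : 0 < (1 + u ^+ n) ^+ (n * k ^ n) by rewrite exprn_gt0// ltr_wpDr.
  (* Here [1 - u ^+ n] is at most the inverse of [1 + u ^+ n]. *)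
  apply: (@le_trans _ _ ((1 + u ^+ n) ^+ (n * k ^ n))^-1).
    rewrite -[leRHS]mul1r ler_pdivlMr// /threshold -exprMn exprn_ile1//.
      by rewrite mulr_ge0//; lra.
    by have := sqr_ge0 (u ^+ n); lra.
  rewrite lef_pV2 ?posrE//; apply: le_trans (bernoulli _ a0).
  rewrite E -natr1 addrC lerD2l -[leLHS]mulr1 ler_wpM2l//.
  exact: exprn_ege1.
- exact: cvg_cst.
- exact: cvg_harmonic.
Qed.

End threshold.

(** * Multipliers preserving a closed subspace *)

Section multipliers.
Variables (R : realType) (H : normedModType R[i]) (mu : spectral_measures R).
Variables (U : H -> l2_fields R).
Hypothesis unitaryU : unitary_onto_L2 mu U.
Local Notation C := (complex_plane R).
Implicit Types (x y : H) (F : l2_fields R) (j : multiplicity).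
Implicit Types (phi psi : C -> R[i]).

Variable W : set H.
Hypothesis Wsub : closed_subspace W.

(** Multiplication by [phi] in the spectral representation preserves [W]. *)
Definition multiplier phi := forall x, W x ->
  exists2 y, W y & ae_eq_field mu (U y) (mul_field phi (U x)).

Lemma eq_multiplier phi psi : phi =1 psi -> multiplier phi -> multiplier psi.
Proof. by move=> /funext ->. Qed.

Lemma multiplier_cst (a : R[i]) : multiplier (fun=> a).
Proof.
by move=> x Wx; exists (a *: x); [exact: closed_subspaceZ|exact: U_Z].
Qed.

Lemma multiplierD phi psi : multiplier phi -> multiplier psi ->
  multiplier (fun z => phi z + psi z).
Proof.
move=> phiW psiW x Wx.
have [y Wy yx] := phiW x Wx; have [z Wz zx] := psiW x Wx.
exists (y + z); first exact: closed_subspaceD.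
apply: ae_eq_field_trans (U_D unitaryU y z) _ => j.
apply: filterS2 (yx j) (zx j) => t; rewrite /add_field /mul_field => -> ->.
by rewrite scalerDl.
Qed.

Lemma multiplierM phi psi : multiplier phi -> multiplier psi ->
  multiplier (fun z => phi z * psi z).
Proof.
move=> phiW psiW x Wx.
have [y Wy yx] := psiW x Wx; have [z Wz zy] := phiW y Wy.
exists z => // j; apply: filterS2 (yx j) (zy j) => t.
by rewrite /mul_field => -> ->; rewrite scalerA.
Qed.

Lemma multiplierX phi n : multiplier phi -> multiplier (fun z => phi z ^+ n).
Proof.
move=> phiW; elim: n => [|n IH]; first exact: multiplier_cst.
apply: (@eq_multiplier (fun z => phi z * phi z ^+ n)) => [z|].
  by rewrite exprS.
exact: multiplierM.
Qed.

Lemma multiplierB phi psi : multiplier phi -> multiplier psi ->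
  multiplier (fun z => phi z - psi z).
Proof.
move=> phiW psiW; apply: multiplierD => //.
apply: (@eq_multiplier (fun z => -1 * psi z)) => [z|]; first by rewrite mulN1r.
by apply: multiplierM => //; exact: multiplier_cst.
Qed.

(** Multipliers are stable under bounded pointwise limits. *)
Lemma multiplier_cvg (phi : nat -> C -> R[i]) psi :
  (forall n, multiplier (phi n)) ->
  (forall n, measurable_fun setT (phi n : C -> C)) ->
  measurable_fun setT (psi : C -> C) ->
  (forall j, {ae mu j, forall z, Normc.normc (psi z) ^+ 2 <= 1}) ->
  (forall j, {ae mu j, forall z, forall n,
    Normc.normc (psi z - phi n z) ^+ 2 <= 1}) ->
  (forall j, {ae mu j, forall z,
    (fun n => Normc.normc (psi z - phi n z) ^+ 2) @ \oo --> (0 : R)}) ->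
  multiplier psi.
Proof.
move=> phiW mphi mpsi psi1 bnd cvg x Wx.
have mF : measurable_field (mul_field psi (U x)).
  exact: measurable_mul_field mpsi (U_measurable unitaryU x).
have [y yx] : exists y, ae_eq_field mu (U y) (mul_field psi (U x)).
  apply: (U_onto unitaryU); split => //.
  apply: (@le_lt_trans _ _ (field_sqnorm mu (U x))); last first.
    by case: (U_L2 unitaryU x).
  apply: (le_field_sqnorm mF (U_measurable unitaryU x)).
  move=> j; apply: filterS (psi1 j) => z psiz k.
  rewrite /mul_field l2_valZ Normc.normcM exprMn ler_piMl ?sqr_ge0//.
exists y => //; have [Wcl _ _] := Wsub; apply: Wcl; apply/closure_rnormP => e e0.
have /choice[v vP] : forall n, exists v,
    W v /\ ae_eq_field mu (U v) (mul_field (phi n) (U x)).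
  by move=> n; have [v Wv vx] := phiW n x Wx; exists v.
pose theta n z := psi z - phi n z.
have mtheta n : measurable_fun setT (theta n : C -> C).
  have m1 : measurable_fun setT ((fun=> -1) : C -> C).
    exact: measurable_complex_cst.
  have := measurable_complexD mpsi (measurable_complexM m1 (mphi n)).
  by under eq_fun do rewrite mulN1r.
have vE n : field_sqnorm mu (mul_field (theta n) (U x)) = (rnorm (y - v n) ^+ 2)%:E.
  apply: (rnorm_field unitaryU).
    exact: measurable_mul_field (mtheta n) (U_measurable unitaryU x).
  apply: ae_eq_field_trans (U_B unitaryU y (v n)) _ => j.
  apply: filterS2 (yx j) ((vP n).2 j) => z; rewrite /add_field /mul_field => -> ->.
  by rewrite scaleN1r -scalerBl.
have := field_sqnorm_cvg0 mtheta (U_L2 unitaryU x) bnd cvg.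
under eq_fun do rewrite vE.
move/fine_cvgP => [_] /cvgrPdist_lt /(_ _ (exprn_gt0 2 e0)) [N _ /(_ N (leqnn N))].
rewrite /= sub0r normrN ger0_norm ?sqr_ge0// => yv.
exists (v N); first by case: (vP N).
by rewrite -(@ltr_pXn2r _ 2) ?nnegrE ?rnorm_ge0 ?(ltW e0).
Qed.

Hypothesis Wz : multiplier id.
Hypothesis Wzbar : multiplier (fun z => (z : R[i])^*%C).
Variable M : R.
Hypothesis zM : forall j, {ae mu j, forall z, Normc.normc (z : R[i]) <= M}.

Let measurable_idC : measurable_fun setT (fun z : C => z : C).
Proof. exact: measurable_id. Qed.

Lemma measurable_ball (c : R[i]) (r : R) :
  measurable [set z : C | Normc.normc ((z : R[i]) - c) < r].
Proof.
have mc : measurable_fun setT (fun z : C => (z : R[i]) - c : C).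
  exact: (measurable_complexD measurable_idC
    (@measurable_complex_cst R _ C (- c))).
have [r0|r0] := leP 0 r; last first.
  rewrite (_ : [set _ | _] = set0)// -subset0 => z /= zr.
  by have := le_lt_trans (normc_ge0' _) (lt_trans zr r0); rewrite ltxx.
have -> : [set z : C | Normc.normc ((z : R[i]) - c) < r] =
    [set z : C | Normc.normc ((z : R[i]) - c) ^+ 2 < r ^+ 2].
  by apply/seteqP; split=> z /=; rewrite ltr_pXn2r// ?nnegrE ?normc_ge0'.
rewrite -[X in measurable X]setTI; apply: measurable_fun_ltr => //.
exact: measurable_sqr_normc mc.
Qed.

(** The characteristic function of a disc is the bounded limit of polynomials
    in [z] and its conjugate, applied to a multiple of the squared distance to
    the centre. *)
Lemma multiplier_ball (c : R[i]) (r : R) : 0 < r ->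
  multiplier (cindic [set z : C | Normc.normc ((z : R[i]) - c) < r]).
Proof.
move=> r0.
(* On the disc of radius [M], [k.+1 * r ^+ 2] bounds the squared distance to
   [c], so that [u] below takes values in the unit interval; and [u * k.+1 < 1]
   defines the disc of centre [c] and radius [r]. *)
have [k kM] : exists k : nat, ((M + Normc.normc c) / r) ^+ 2 <= k%:R.
  exists (Num.truncn (((M + Normc.normc c) / r) ^+ 2)).+1.
  by rewrite ltW// truncnS_gt.
pose b : R := k.+1%:R * r ^+ 2.
have b0 : 0 < b by rewrite mulr_gt0// exprn_gt0.
pose u (z : C) : R := Normc.normc ((z : R[i]) - c) ^+ 2 / b.
have uE z : (u z)%:C%C =
    ((z : R[i]) - c) * ((z : R[i])^*%C - c^*%C) * (b^-1)%:C%C.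
  rewrite /u rmorphM/= -rmorphB -sqr_normc norm_normc rmorphXn.
  by [].
have uW : multiplier (fun z => (u z)%:C%C).
  apply: (@eq_multiplier (fun z : C =>
     ((z : R[i]) - c) * ((z : R[i])^*%C - c^*%C) * (b^-1)%:C%C)) => [z|].
    by rewrite uE.
  apply: multiplierM; last exact: multiplier_cst.
  apply: multiplierM; apply: multiplierB => //; exact: multiplier_cst.
have mc : measurable_fun setT (fun z : C => (z : R[i]) - c : C).
  exact: (measurable_complexD measurable_idC
    (@measurable_complex_cst R _ C (- c))).
have mu' : measurable_fun setT u.
  by apply: measurable_funM => //; exact: measurable_sqr_normc mc.
pose q n (z : C) : R[i] := (threshold k.+1 n (u z))%:C%C.
have u01 j : {ae mu j, forall z, 0 <= u z <= 1}.
  have aeF := ae_filter_ringOfSetsType (mu j).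
  apply: (@filterS _ _ aeF _ _ _ (zM j)) => z zM1.
  rewrite /u divr_ge0 ?sqr_ge0 ?(ltW b0)//= ler_pdivrMr// mul1r.
  apply: (@le_trans _ _ ((M + Normc.normc c) ^+ 2)).
    rewrite ler_pXn2r// ?nnegrE ?addr_ge0 ?normc_ge0'//.
      by rewrite (le_trans (normcD_le _ _))// normcN lerD2r.
    exact: le_trans (normc_ge0' z) zM1.
  rewrite /b -ler_pdivrMr ?exprn_gt0// -expr_div_n (le_trans kM)//.
  by rewrite ler_nat.
have ballE z : [set z : C | Normc.normc ((z : R[i]) - c) < r] z =
    (u z * k.+1%:R < 1) :> Prop.
  congr is_true; rewrite /u /b invfM mulrA mulrAC divfK//.
  rewrite ltr_pdivrMr ?exprn_gt0// mul1r ltr_pXn2r// nnegrE ?normc_ge0'//.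
  exact: ltW.
have indE z : cindic [set z : C | Normc.normc ((z : R[i]) - c) < r] z =
    (if u z * k.+1%:R < 1 then 1 else 0)%:C%C.
  rewrite /cindic indicE; case: ifPn => uz; first by rewrite mem_set// ballE.
  by rewrite memNset// ballE; exact/negP.
have subR (a a' : R) : Normc.normc (a%:C%C - a'%:C%C) ^+ 2 = (a - a') ^+ 2.
  by rewrite -rmorphB sqr_normcE/= expr0n/= addr0.
apply: (@multiplier_cvg q).
- move=> n.
  apply: (@eq_multiplier (fun z => (1 - (u z)%:C%C ^+ n) ^+ (n * k.+1 ^ n))).
    by move=> z; rewrite /q /threshold rmorphXn rmorphB rmorph1 rmorphXn.
  apply: multiplierX; apply: multiplierB; first exact: multiplier_cst.
  exact: multiplierX.
- move=> n; apply: measurable_complex_real; rewrite /threshold.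
  apply: measurable_funX; apply: measurable_funB => //; exact: measurable_funX.
- by apply: measurable_cindic; exact: measurable_ball.
- move=> j; apply: aeW => z; rewrite indE sqr_normcE/= expr0n/= addr0.
  by case: ifP; rewrite ?expr1n ?expr0n.
- move=> j; apply: filterS (u01 j) => z uz n; rewrite indE subR.
  have /andP[q0 q1] := threshold_itv k.+1 n uz.
  by case: ifP => _; rewrite ?sub0r ?sqrrN exprn_ile1//; lra.
- move=> j; apply: filterS (u01 j) => z uz; rewrite indE.
  under eq_fun do rewrite subR.
  set a : R := if _ then _ else _.
  have : (fun n => a - threshold k.+1 n (u z)) @ \oo --> a - a.
    by apply: cvgB; [exact: cvg_cst|exact: threshold_cvg].
  by rewrite subrr => h; have := cvgM h h; rewrite mulr0; apply.
Qed.


(* It suffices to show that these sets form a sigma-algebra containing the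
   discs. *)
Let Sigma : set (set C) := [set E | measurable E /\ multiplier (cindic E)].

Let SigmaC E : Sigma E -> Sigma (~` E).
Proof.
move=> [mE EW]; split; first exact: measurableC.
apply: (@eq_multiplier (fun z => 1 - cindic E z)) => [z|]; last first.
  by apply: multiplierB => //; exact: multiplier_cst.
rewrite /cindic !indicE in_setC (_ : 1 = 1%:C%C)// -rmorphB.
by case: (z \in E); rewrite /= ?subrr ?subr0.
Qed.

Let SigmaU E E' : Sigma E -> Sigma E' -> Sigma (E `|` E').
Proof.
move=> [mE EW] [mE' EW']; split; first exact: measurableU.
apply: (@eq_multiplier
    (fun z => cindic E z + cindic E' z - cindic E z * cindic E' z)).
  move=> z; rewrite /cindic !indicE in_setU -rmorphM -rmorphD -rmorphB.
  apply: (congr1 (real_complex R)).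
  by case: (z \in E); case: (z \in E') => /=; ring.
by apply: multiplierB; [exact: multiplierD|exact: multiplierM].
Qed.

Let Sigma_bigcup (E : (set C)^nat) : (forall n, Sigma (E n)) ->
  Sigma (\bigcup_n E n).
Proof.
move=> SE; split; first by apply: bigcupT_measurable => n; case: (SE n).
pose P n := \big[setU/set0]_(i < n) E i.
have SP n : Sigma (P n).
  elim: n => [|n IH]; rewrite /P; last by rewrite big_ord_recr; exact: SigmaU.
  rewrite big_ord0; split => //.
  apply: (@eq_multiplier (fun=> 0)); last exact: multiplier_cst.
  by move=> z; rewrite /cindic indic0.
have subR (a a' : R) : Normc.normc (a%:C%C - a'%:C%C) ^+ 2 = (a - a') ^+ 2.
  by rewrite -rmorphB sqr_normcE/= expr0n/= addr0.
apply: (@multiplier_cvg (fun n => cindic (P n))).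
- by move=> n; case: (SP n).
- by move=> n; apply: measurable_cindic; case: (SP n).
- by apply: measurable_cindic; apply: bigcupT_measurable => n; case: (SE n).
- move=> j; apply: aeW => z; rewrite sqr_normcE/= expr0n/= addr0 indicE.
  by case: (_ \in _); rewrite ?expr1n ?expr0n.
- move=> j; apply: aeW => z n; rewrite subR !indicE.
  by do 2 case: (_ \in _); rewrite /= ?subrr ?subr0 ?sub0r ?sqrrN ?expr1n ?expr0n.
- move=> j; apply: aeW => z; under eq_fun do rewrite subR.
  apply: cvg_near_cst.
  have [[i _ Ei]|Ez] := pselect ((\bigcup_n E n) z); last first.
    apply: nearW => n; rewrite !indicE memNset// memNset ?subrr ?expr0n//.
    by rewrite /P -bigcup_mkord => -[i _ Ei]; apply: Ez; exists i.
  exists i.+1 => // n /= ni; rewrite !indicE mem_set; last by exists i.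
  by rewrite mem_set ?subrr ?expr0n// /P -bigcup_mkord; exists i.
Qed.

(** The characteristic functions of all Borel sets are multipliers. *)
Lemma multiplier_cindic (E : set C) : measurable E -> multiplier (cindic E).
Proof.
suff : [set E : set C | measurable E] `<=` Sigma by move=> h /h[].
have Sigma0 : Sigma set0.
  split => //; apply: (@eq_multiplier (fun=> 0)); last exact: multiplier_cst.
  by move=> z; rewrite /cindic indic0.
apply: smallest_sub => [|B oB].
  split => // B SB; rewrite setTD; exact: SigmaC.
have [Q ->] := open_rational_balls oB.
pose ball (q : rat * rat * nat) : set C := [set z |
  Normc.normc ((z : R[i]) - (ratr q.1.1 +i* ratr q.1.2)%C) < q.2.+1%:R^-1].
rewrite (_ : \bigcup_(q in Q) _ = \bigcup_n
    (if @choice.unpickle (rat * rat * nat)%type n is Some q then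
       if q \in Q then ball q else set0 else set0)); last first.
  apply/seteqP; split=> [z [q Qq qz]|z [n _]].
    exists (choice.pickle q); first exact: I.
    by rewrite choice.pickleK mem_set.
  case: choice.unpickle => // q; case: ifPn => // /set_mem Qq qz.
  by exists q.
apply: Sigma_bigcup => n; case: choice.unpickle => // q; case: ifP => // _.
split; first exact: measurable_ball.
by apply: multiplier_ball; rewrite invr_gt0.
Qed.

End multipliers.

(** * Boundedness of the spectrum *)

Section spectral_bound.
Variables (R : realType) (H : normedModType R[i]) (mu : spectral_measures R).
Variables (U : H -> l2_fields R) (A : {linear H -> H}).
Hypothesis unitaryU : unitary_onto_L2 mu U.
Hypothesis UA : forall x, ae_eq_field mu (U (A x)) (mul_field id (U x)).
Local Notation C := (complex_plane R).

Lemma mul_single_field (phi : C -> R[i]) j (h : C -> l2 R (Omega j)) :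
  mul_field phi (single_field h) = single_field (fun z => phi z *: h z).
Proof.
apply: functional_extensionality_dep => i; apply/funext => z; rewrite /mul_field.
have [ij|ij] := pselect (i = j); last by rewrite !single_fieldN ?scaler0.
by move: (h); rewrite -ij => g; rewrite !single_fieldE.
Qed.

Lemma Omega_inhabited j : exists k : Omega j, True.
Proof. by case: j => [n|]; [exists ord0|exists 0%N]. Qed.

(** The spectral measures are carried by a disc, of radius any bound of the
    norm of the operator. *)
Lemma spectral_bound (M : R) j : 0 <= M ->
  (forall x, rnorm (A x) <= M * rnorm x) ->
  {ae mu j, forall z, Normc.normc (z : R[i]) <= M}.
Proof.
move=> M0 AM; have [k _] := Omega_inhabited j.
have mid : measurable_fun setT (fun z : C => z : C) by exact: measurable_id.
have mn : measurable_fun setT (fun z : C => Normc.normc (z : R[i]) ^+ 2).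
  exact: measurable_sqr_normc.
pose E : set C := [set z | M ^+ 2 < Normc.normc (z : R[i]) ^+ 2].
have mE : measurable E.
  by rewrite -[E]setTI; apply: measurable_fun_ltr => //; exact: measurable_cst.
pose h (phi : C -> R[i]) z := phi z *: delta R k.
have mh (phi : C -> C) i : measurable_fun setT phi ->
    measurable_fun setT (fun z => h phi z i : C).
  move=> mphi.
  exact: (measurable_complexM mphi (@measurable_complex_cst R _ C _)).
have hE phi z : sqnorm (h phi z) = (Normc.normc (phi z) ^+ 2)%:E.
  by rewrite /h sqnormZ sqnorm_delta mule1.
have indE z (a : R[i]) :
    Normc.normc (a * cindic E z) ^+ 2 = \1_E z * Normc.normc a ^+ 2.
  by rewrite mulrC sqr_normc_cindic.
have ind1 z : Normc.normc (cindic E z) ^+ 2 = \1_E z.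
  by rewrite -[cindic E z]mul1r indE Normc.normc1 expr1n mulr1.
(* A test vector living on the set [E] where the bound fails. *)
have [x xh] : exists x, ae_eq_field mu (U x) (single_field (h (cindic E))).
  apply: (U_onto unitaryU); apply: finite_measure_field => [i|z].
    exact: mh (measurable_cindic mE).
  by rewrite hE ind1 lee_fin indicE; case: (_ \in _).
have xE : (rnorm x ^+ 2)%:E = mu j E.
  rewrite -(rnorm_field unitaryU _ xh); last first.
    by apply: measurable_single_field => i; exact: mh (measurable_cindic mE).
  rewrite field_sqnorm_single; last by move=> i; exact: mh (measurable_cindic mE).
  under eq_integral do rewrite hE ind1.
  by rewrite integral_indic// setIT.
have mzE : measurable_fun setT ((fun z => (z : R[i]) * cindic E z) : C -> C).
  exact: measurable_complexM mid (measurable_cindic mE).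
have AxE : (rnorm (A x) ^+ 2)%:E =
    (\int[mu j]_z (\1_E z * Normc.normc (z : R[i]) ^+ 2)%:E)%E.
  have Axh : ae_eq_field mu (U (A x))
      (single_field (h (fun z => (z : R[i]) * cindic E z))).
    apply: ae_eq_field_trans (UA x) _.
    apply: ae_eq_field_trans (ae_eq_mul_field id xh) _.
    rewrite mul_single_field => i; apply: aeW => z; congr (single_field _ i z).
    by apply/funext => w; rewrite /h scalerA.
  rewrite -(rnorm_field unitaryU _ Axh); last first.
    by apply: measurable_single_field => i; exact: mh.
  rewrite field_sqnorm_single; last by move=> i; exact: mh.
  by under eq_integral do rewrite hE indE.
pose f z := (\1_E z * (Normc.normc (z : R[i]) ^+ 2 - M ^+ 2))%:E.
have f0 z : (0 <= f z)%E.
  rewrite lee_fin indicE; have [zE|zE] := pselect (E z); last first.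
    by rewrite memNset// mul0r.
  by rewrite mem_set// mul1r subr_ge0 ltW.
have mf : measurable_fun setT f.
  apply/measurable_EFinP; apply: measurable_funM; first exact: measurable_indic.
  exact: measurable_funB.
have fint : (\int[mu j]_z f z + (M ^+ 2)%:E * mu j E = (rnorm (A x) ^+ 2)%:E)%E.
  rewrite AxE -[E in mu j E]setIT -integral_indic//.
  rewrite -ge0_integralZl_EFin//; first last.
  - exact: sqr_ge0.
  - by apply/measurable_EFinP; exact: measurable_indic.
  rewrite -ge0_integralD//; first last.
  - by apply: measurable_funeM; apply/measurable_EFinP; exact: measurable_indic.
  - by move=> z _; rewrite -EFinM lee_fin mulr_ge0 ?sqr_ge0.
  by apply: eq_integral => z _; rewrite -EFinM -EFinD; congr EFin; ring.
have fint0 : (\int[mu j]_z `|f z| = 0)%E.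
  under eq_integral do rewrite gee0_abs//.
  have : (0 <= \int[mu j]_z f z)%E by exact: integral_ge0.
  have : rnorm (A x) ^+ 2 <= M ^+ 2 * rnorm x ^+ 2.
    by rewrite -exprMn ler_pXn2r// ?nnegrE ?rnorm_ge0// mulr_ge0// rnorm_ge0.
  move: fint; rewrite -xE -EFinM; case: (\int[mu j]_z f z)%E => [r| |]//.
  by rewrite -EFinD => -[<-] h1; rewrite lee_fin => h2; congr EFin; lra.
have := (ae_eq_integral_abs (mu j) measurableT mf).1 fint0.
apply: filterS => z /(_ I) /= fz.
rewrite -(@ler_pXn2r _ 2) ?nnegrE ?normc_ge0'// leNgt; apply/negP => zE.
move: fz; rewrite /f indicE mem_set// mul1r => -[] /eqP.
by rewrite subr_eq0 => /eqP e; move: zE; rewrite e ltxx.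
Qed.

End spectral_bound.

(** * Reducing subspaces in the spectral representation *)

Section mutual_singularity.
Variables (R : realType) (mu : spectral_measures R).
Local Notation C := (complex_plane R).

(** A Borel set carrying one spectral measure and negligible for the others. *)
Lemma separating_set j :
  (forall i j, i <> j -> mutually_singular (mu i) (mu j)) ->
  exists S : set C, [/\ measurable S, mu j (~` S) = 0%E &
    forall i, i <> j -> mu i S = 0%E].
Proof.
move=> sing.
have /choice[N NP] : forall i, exists N : set C,
    [/\ measurable N, mu j (~` N) = 0%E & i <> j -> mu i N = 0%E].
  move=> i; have [->|/eqP ij] := eqVneq i j.
    by exists setT; split => //; rewrite setCT measure0.
  by have [N [mN iN jN]] := sing _ _ ij; exists N; split.
pose N' n := oapp N setT (@choice.pickle_inv multiplicity n).
have mN' n : measurable (N' n).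
  by rewrite /N'; case: choice.pickle_inv => [i|] //=; case: (NP i).
exists (\bigcap_n N' n); split.
- exact: bigcapT_measurable.
- apply/negligibleP; first by apply: measurableC; exact: bigcapT_measurable.
  rewrite setC_bigcap; apply: negligible_bigcup => n.
  apply/negligibleP; first exact: measurableC.
  rewrite /N'; case: choice.pickle_inv => [i|] /=; first by case: (NP i).
  by rewrite setCT measure0.
- move=> i ij; have [mNi _ /(_ ij) Ni0] := NP i.
  apply: (@subset_measure0 _ _ _ (mu i) _ (N i)) => //.
    exact: bigcapT_measurable.
  by move=> z /(_ (choice.pickle i) I); rewrite /N' choice.pickleK_inv.
Qed.

End mutual_singularity.

Section normal_representation.
Variables (R : realType) (H : completeNormedModType R[i]).
Variable dot : {dot H for Num.conj}.
Hypothesis norm_dot : forall x : H, `|x| ^+ 2 = dot x x.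
Variables (mu : spectral_measures R) (U : H -> l2_fields R) (A : {linear H -> H}).
Hypothesis unitaryU : unitary_onto_L2 mu U.
Hypothesis UA : forall x, ae_eq_field mu (U (A x)) (mul_field id (U x)).
Hypothesis sing : forall i j, i <> j -> mutually_singular (mu i) (mu j).
Local Notation C := (complex_plane R).
Implicit Types (x y f g : H) (V : set H) (E : set C).

Let zbar : C -> R[i] := fun z => (z : R[i])^*%C.

Let measurable_idC : measurable_fun setT (fun z : C => z : C).
Proof. exact: measurable_id. Qed.

Let measurable_zbar : measurable_fun setT (zbar : C -> C).
Proof. exact: (measurable_complex_conj measurable_idC). Qed.

Let Um := U_measurable unitaryU.

Lemma conj_field_exists y :
  exists y', ae_eq_field mu (U y') (mul_field zbar (U y)).
Proof.
apply: (U_onto unitaryU); split; first exact: measurable_mul_field.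
apply: (@le_lt_trans _ _ (field_sqnorm mu (mul_field id (U y)))).
  apply: le_field_sqnorm; [exact: measurable_mul_field..|].
  move=> j; apply: aeW => z k; rewrite /mul_field !l2_valZ !Normc.normcM !exprMn.
  by rewrite !sqr_normcE /zbar; case: (z : R[i]) => a b /=; rewrite sqrrN.
rewrite (rnorm_field unitaryU _ (UA y)) ?ltry//.
exact: measurable_mul_field.
Qed.

(** Multiplication by the conjugate of the coordinate represents the adjoint of
    [A]: polarization of the identity [xv] below between norms. *)
Lemma conj_adjoint x y y' : ae_eq_field mu (U y') (mul_field zbar (U y)) ->
  dot (A x) y = dot x y'.
Proof.
have ReE v v' : ae_eq_field mu (U v') (mul_field zbar (U v)) ->
    complex.Re (dot (A x) v) = complex.Re (dot x v').
  move=> vv'.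
  have m1 : measurable_fun setT ((fun=> -1) : C -> C).
    exact: measurable_complex_cst.
  have mz w : measurable_field (mul_field id (U w)).
    exact: measurable_mul_field.
  have mb w : measurable_field (mul_field zbar (U w)).
    exact: measurable_mul_field.
  have mN (F : l2_fields R) : measurable_field F ->
      measurable_field (mul_field (fun=> -1) F).
    by move=> mF; exact: measurable_mul_field.
  have mx := mz x; have mv := mb v.
  have xv : forall j z k,
      Normc.normc (add_field (mul_field id (U x)) (U v) j z k) ^+ 2 +
      Normc.normc (add_field (U x)
        (mul_field (fun=> -1) (mul_field zbar (U v))) j z k) ^+ 2 =
      Normc.normc (add_field (U x) (mul_field zbar (U v)) j z k) ^+ 2 +
      Normc.normc (add_field (mul_field id (U x))
        (mul_field (fun=> -1) (U v)) j z k) ^+ 2.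
    move=> j z k; rewrite /add_field /mul_field !l2_valD !l2_valZ /zbar !sqr_normcE.
    case: (z : R[i]) (U x j z k) (U v j z k) => [a b] [c e] [p q] /=; ring.
  have := field_sqnorm_identity mu (measurable_add_field mx (Um v))
    (measurable_add_field (Um x) (mN _ mv)) (measurable_add_field (Um x) mv)
    (measurable_add_field mx (mN _ (Um v))) xv.
  have e1 : ae_eq_field mu (U (A x + v)) (add_field (mul_field id (U x)) (U v)).
    apply: ae_eq_field_trans (U_D unitaryU _ _) _.
    by apply: ae_eq_add_field; [exact: UA|exact: ae_eq_field_refl].
  have e2 : ae_eq_field mu (U (x - v'))
      (add_field (U x) (mul_field (fun=> -1) (mul_field zbar (U v)))).
    apply: ae_eq_field_trans (U_B unitaryU _ _) _.
    by apply: ae_eq_add_field; [exact: ae_eq_field_refl|exact: ae_eq_mul_field].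
  have e3 : ae_eq_field mu (U (x + v')) (add_field (U x) (mul_field zbar (U v))).
    apply: ae_eq_field_trans (U_D unitaryU _ _) _.
    by apply: ae_eq_add_field; [exact: ae_eq_field_refl|].
  have e4 : ae_eq_field mu (U (A x - v))
      (add_field (mul_field id (U x)) (mul_field (fun=> -1) (U v))).
    apply: ae_eq_field_trans (U_B unitaryU _ _) _.
    by apply: ae_eq_add_field; [exact: UA|exact: ae_eq_field_refl].
  rewrite (rnorm_field unitaryU _ e1) ?(rnorm_field unitaryU _ e2)
    ?(rnorm_field unitaryU _ e3) ?(rnorm_field unitaryU _ e4); first last.
  - exact: measurable_add_field.
  - exact: measurable_add_field (mN _ mv).
  - exact: measurable_add_field.
  - exact: measurable_add_field (mN _ (Um v)).
  rewrite -!EFinD => -[]; rewrite !(rnormD_sqr norm_dot) !Re_dotN !rnormN; lra.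
move=> yy'; apply/eqP; rewrite eq_complex (ReE _ _ yy') eqxx/= -!dot_i.
apply/eqP; apply: ReE => j.
apply: filterS3 (U_Z unitaryU 'i%C y' j) (U_Z unitaryU 'i%C y j) (yy' j).
by move=> z; rewrite /mul_field => -> -> ->; rewrite !scalerA mulrC.
Qed.

(** The orthogonal complement of an [A]-invariant subspace is invariant under
    multiplication by the conjugate of the coordinate. *)
Lemma orthogonal_complement_conj V : Defs.invariant A V ->
  multiplier mu U (orthogonal_complement dot V) zbar.
Proof.
move=> AV y yV; have [y' yy'] := conj_field_exists y; exists y' => // v Vv.
have AvV : V (A v) by apply: AV; exists v.
by rewrite dotC -(conj_adjoint v yy') dotC yV// !rmorph0.
Qed.

(** If multiplication by the characteristic functions of Borel sets preserves
    [W], then orthogonality to [W] holds pointwise, at almost every point. *)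
Lemma ae_pythagorean (W : set H) f g j : closed_subspace W ->
  (forall E, measurable E -> multiplier mu U W (cindic E)) ->
  W f -> (forall w, W w -> dot w g = 0) ->
  {ae mu j, forall z, pythagorean (U f j z) (U g j z)}.
Proof.
move=> Wsub WE Wf Wg; have [S [mS jS iS]] := separating_set j sing.
have mfg := measurable_add_field (Um f) (Um g).
have fsE E : measurable E ->
    (field_sqnorm mu (mul_field (cindic E) (add_field (U f) (U g))) =
    field_sqnorm mu (mul_field (cindic E) (U f)) +
    field_sqnorm mu (mul_field (cindic E) (U g)))%E.
  move=> mE; have mcE := measurable_cindic mE.
  have [w Ww wf] := WE E mE f Wf.
  have wgE : ae_eq_field mu (U (w + g))
      (add_field (mul_field (cindic E) (U f)) (U g)).
    apply: ae_eq_field_trans (U_D unitaryU _ _) _.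
    by apply: ae_eq_add_field; [|exact: ae_eq_field_refl].
  have mEf := measurable_mul_field mcE (Um f).
  have mEg := measurable_mul_field mcE (Um g).
  have := @field_sqnorm_identity R mu _ _ _ _
    (measurable_add_field mEf (Um g)) mEg (measurable_mul_field mcE mfg) (Um g) _.
  move=> /(_ _)/wrap[|].
    move=> i z k; rewrite /add_field /mul_field /cindic indicE.
    by case: (z \in E); rewrite /= ?scale1r ?scale0r ?add0r// addrC.
  rewrite (rnorm_field unitaryU _ wgE); last exact: measurable_add_field.
  rewrite (rnorm_field unitaryU mEf wf) (U_norm unitaryU).
  rewrite (rnormD_sqr norm_dot) Wg//.
  rewrite mulr0 addr0.
  move: (field_sqnorm _ _) (field_sqnorm _ _) => [a| |] [b| |]//.
  by rewrite -!EFinD => -[] ?; congr EFin; lra.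
have intE E : E `<=` S -> measurable E ->
    (\int[mu j]_(z in E) sqnorm (U f j z + U g j z)%R =
     \int[mu j]_(z in E) (sqnorm (U f j z) + sqnorm (U g j z)))%E.
  move=> ES mE.
  have E0 i : i <> j -> mu i E = 0%E.
    by move=> ij; apply: (@subset_measure0 _ _ _ (mu i) E S) => //; exact: iS.
  have := fsE E mE; rewrite !(@field_sqnorm_cindic _ _ j)// => ->.
  rewrite ge0_integralD//.
  - by move=> z _; exact: sqnorm_ge0.
  - by apply: measurable_funTS; exact: measurable_sqnorm.
  - by move=> z _; exact: sqnorm_ge0.
  - by apply: measurable_funTS; exact: measurable_sqnorm.
have mfgj : measurable_fun setT (fun z => sqnorm (U f j z + U g j z)).
  exact: (measurable_sqnorm j mfg).
have sum_m : measurable_fun setT (fun z => sqnorm (U f j z) + sqnorm (U g j z))%E.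
  by apply: emeasurable_funD; exact: measurable_sqnorm.
have ifg : (mu j).-integrable S (fun z => sqnorm (U f j z + U g j z)).
  apply/integrableP; split; first exact: measurable_funTS.
  under eq_integral do rewrite gee0_abs ?sqnorm_ge0//.
  rewrite intE//; apply: (@le_lt_trans _ _
    (\int[mu j]_z (sqnorm (U f j z) + sqnorm (U g j z)))%E).
    by apply: ge0_subset_integral => // z _; rewrite adde_ge0// sqnorm_ge0.
  rewrite ge0_integralD//; last 4 first.
  - by move=> z _; exact: sqnorm_ge0.
  - exact: measurable_sqnorm.
  - by move=> z _; exact: sqnorm_ge0.
  - exact: measurable_sqnorm.
  rewrite lte_add_pinfty//;
    by rewrite (le_lt_trans (integral_sqnorm_le unitaryU _ _))// ltry.
have := integral_ae_eq mS ifg (measurable_funTS sum_m) intE.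
have aeS : {ae mu j, forall z, S z}.
  by exists (~` S); split => //; exact: measurableC.
move=> eqS; apply: filterS2 aeS eqS => z Sz /(_ Sz).
by rewrite /pythagorean -!sqE -EFinD => -[].
Qed.

End normal_representation.

(** * Completeness of the orbits *)

Section bounded_operators.
Variables (R : realType) (H : normedModType R[i]) (A : {linear H -> H}).

Lemma bounded_operator_rnorm : bounded_operator A ->
  exists2 M : R, 0 <= M & forall x, rnorm (A x) <= M * rnorm x.
Proof.
move=> [M AM]; exists `|complex.Re M|; first exact: normr_ge0.
move=> x; have := AM x; rewrite !rnormE lecE => /andP[_] /=.
have -> : complex.Re (M * (rnorm x)%:C%C) = complex.Re M * rnorm x.
  by case: (M) => a b /=; rewrite mulr0 subr0.
by move=> /le_trans; apply; rewrite ler_wpM2r ?rnorm_ge0// ler_norm.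
Qed.

Lemma orbit_closure_invariant G : bounded_operator A ->
  Defs.invariant A (closure (Defs.span (orbit_system A G))).
Proof.
move=> /bounded_operator_rnorm[M M0 AM] _ [x xS <-].
apply/closure_rnormP => e e0.
have M1 : 0 < M + 1 by rewrite ltr_wpDl.
have [y Sy xy] := (closure_rnormP _ _).1 xS _ (divr_gt0 e0 M1).
exists (A y).
  move: y Sy {xy}; apply: span_sub.
  - by rewrite linear0; exact: span0.
  - by move=> a u v uS vS; rewrite linearP; exact: span_lin.
  - move=> _ [g [n [Gg ->]]]; apply: span_gen; exists g, n.+1.
    by rewrite iterS.
rewrite -linearB (le_lt_trans (AM _))//.
apply: (@le_lt_trans _ _ ((M + 1) * rnorm (x - y))).
  by rewrite ler_wpM2r ?rnorm_ge0// lerDl.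
by move: xy; rewrite ltr_pdivlMr// mulrC.
Qed.

End bounded_operators.

Lemma ae_countable d (T : measurableType d) (R : realType)
    (mu : {measure set T -> \bar R}) (I : choiceType) (D : set I)
    (P : I -> T -> Prop) : countable D ->
  (forall i, D i -> {ae mu, forall z, P i z}) ->
  {ae mu, forall z, forall i, D i -> P i z}.
Proof.
move=> /countable_injP[h hinj] DP.
have : {ae mu, forall z, forall n, forall i, D i -> h i = n -> P i z}.
  apply: ae_foralln => n.
  have [[i [Di hi]]|ni] := pselect (exists i, D i /\ h i = n).
    apply: filterS (DP i Di) => z Piz i' Di' hi'.
    suff -> : i' = i by [].
    by apply: hinj; [exact: mem_set|exact: mem_set|rewrite hi'].
  by apply: aeW => z i Di hi; exfalso; apply: ni; exists i.
by apply: filterS => z Pz i Di; exact: Pz.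
Qed.

Theorem theorem3p1 (R : realType) (H : completeNormedModType R[i])
    (dot : {dot H for Num.conj})
    (norm_dot : forall x : H, `|x| ^+ 2 = dot x x)
    (sepH : separable H) (infH : infinite_dimensional H)
    (A : {linear H -> H}) (bndA : bounded_operator A)
    (normA : normal_operator dot A)
    (mu : spectral_measures R) (U : H -> l2_fields R)
    (repr : spectral_representation mu A U) :
  (forall G : set H, countable G ->
     complete_system (orbit_system A G) ->
     forall j : multiplicity,
       {ae mu j, forall z, complete_system [set U g j z | g in G]}) /\
  (reductive dot A ->
   forall G : set H, countable G ->
     (complete_system (orbit_system A G) <->
      forall j : multiplicity,
        {ae mu j, forall z, complete_system [set U g j z | g in G]})).
Proof.
have [_ sing unitaryU UA] := repr.
have fibres G : complete_system (orbit_system A G) -> forall j : multiplicity,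
    {ae mu j, forall z, complete_system [set U g j z | g in G]}.
  by move=> cG j; exact: (complete_fibres unitaryU UA).
split=> [G _|redA G cntG]; first exact: fibres.
split=> [|fibG]; first exact: fibres.
pose V := closure (Defs.span (orbit_system A G)).
have Vsub : closed_subspace V by exact: closure_span_subspace.
have AV : Defs.invariant A V by exact: orbit_closure_invariant.
pose W := orthogonal_complement dot V.
have Wsub : closed_subspace W := closed_orthogonal_complement norm_dot V.
have AW : Defs.invariant A W by exact: redA.
have Wz : multiplier mu U W id.
  by move=> x Wx; exists (A x); [apply: AW; exists x|exact: UA].
have Wzbar := orthogonal_complement_conj norm_dot unitaryU UA AV.
have [M M0 AM] := bounded_operator_rnorm bndA.
have zM j := spectral_bound unitaryU UA j M0 AM.
have WE (E : set (complex_plane R)) : measurable E -> multiplier mu U W (cindic E).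
  exact: (multiplier_cindic unitaryU Wsub Wz Wzbar zM).
suff : V = setT by [].
apply: (orthogonal_complement_trivial norm_dot Vsub) => f Wf.
apply: (U_inj0 unitaryU) => j.
have orth g : V g -> {ae mu j, forall z, pythagorean (U f j z) (U g j z)}.
  move=> Vg; apply: (ae_pythagorean norm_dot unitaryU sing j Wsub WE Wf).
  by move=> w; apply.
have GV g : G g -> V g.
  by move=> Gg; apply/subset_closure/span_gen; exists g, 0%N.
have fG : {ae mu j, forall z, forall g, G g -> pythagorean (U f j z) (U g j z) /\
    pythagorean (U f j z) ('i%C *: U g j z)}.
  apply: ae_countable => // g Gg.
  have Vg := GV g Gg; have Vig := closed_subspaceZ 'i%C Vsub Vg.
  apply: filterS3 (orth g Vg) (orth _ Vig) (U_Z unitaryU 'i%C g j) => z.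
  by rewrite /mul_field => fg + gE; rewrite gE.
apply: filterS2 (fibG j) fG => z cz fz.
by apply: pythagorean_complete cz => _ [g Gg <-]; exact: fz.
Qed.
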